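(* Let $h$ be a random tornado tabulation hash function with $d$ derived characters, $\varphi$ a selector with $\mu=\mathbb E|X|\le|\Sigma|/2$, and $S_i,\bar h,\mathcal J,f,\bar\mu_i$ as in the context; let $S_{\le2}=S_1+S_2$. Let $s_{sec}>0$ and $0<p<1$ satisfy $\ln(s_{sec}/p)\le\bar\mu_2$. Then \[ \Pr\Big[S_{\le2}\le\mathbb E[S_{\le2}\mid\bar h]-\sqrt{2\ln(1/p)\,\mu\,(1+\varepsilon_2)}-\tfrac23\ln(1/p)\Big]<\Big(1+\frac{2}{s_{sec}}\Big)p+2\Pr[\neg\mathcal J], \] where $\varepsilon_2=\sqrt{6\ln(s_{sec}/p)/|\Sigma|}+\big(\tfrac29\ln(1/p)+2\big)/\mu$.
   Context: $\Sigma$ is identified with $k$-bit strings under XOR, $\mathcal R=[2^r]$ with $r$-bit strings. Simple tabulation $g:\Sigma^m\to\mathcal R'$: independent fully random tables, $g(y)=\bigoplus_jT_j[y_j]$. Tornado tabulation with $d$ derived characters: derived key $\tilde x\in\Sigma^{c+d}$ of $x=x_1\cdots x_c$ has $\tilde x_i=x_i$ ($i<c$), $\tilde x_c=x_c\oplus h_0(x_1\cdots x_{c-1})$, $\tilde x_{c+i}=\tilde h_i(\tilde x_1\cdots\tilde x_{c+i-1})$ ($1\le i\le d$), $h_0,\tilde h_i$ simple tabulation into $\Sigma$; $h(x)=\hat h(\tilde x)$ for simple tabulation $\hat h$ with tables $\hat T_1,\dots,\hat T_{c+d}$; all tables independent. Selector $\varphi:\Sigma^c\times\mathcal R\to\{0,1\}$,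 $\varphi(x,r)$ depending only on $x$ and fixed bits of $r$; $X=\{x:\varphi(x,h(x))=1\}$, $\mu=\mathbb E|X|$, $f=\mu/|\Sigma|$, $\bar\mu_i=|\Sigma|f^i/i!$. $\bar h(x)=(\bar h[0](x),\bar h[1](x))$ with $\bar h[1](x)=\tilde x_{c+d}$, $\bar h[0](x)=\bigoplus_{j<c+d}\hat T_j[\tilde x_j]$; $\mathbb E[\cdot\mid\bar h]$ is conditional on the random function $\bar h$. $X_\alpha=\{x\in X:\tilde x_{c+d}=\alpha\}$, $S_i=|\{\alpha\in\Sigma:|X_\alpha|\ge i\}|$. A family of keys (viewed as sets of position characters) is linearly independent if no nonempty subfamily has every position character occurring an even number of times; $\mathcal J$ is the event that $(\tilde x_1\cdots\tilde x_{c+d-1})_{x\in X}$ is linearly independent. *)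

(* Defs.v *)
From HB Require Import structures.
From mathcomp Require Import all_boot all_order all_algebra.
From mathcomp Require Import reals exp.

Set Implicit Arguments.
Unset Strict Implicit.
Unset Printing Implicit Defensive.

Import Order.TTheory GRing.Theory Num.Theory.
Local Open Scope ring_scope.

(* Addition on [bool] is [addb], so the pointwise [+] that [bits n] inherits is
   bitwise XOR, its [0] is the null string, and [\sum] is iterated XOR. *)
Notation bits n := {ffun 'I_n -> bool} (only parsing).

(* The alphabet Sigma is [bits k]; keys are words of length c over it. *)
Notation key k c := (c.-tuple (bits k)) (only parsing).

Notation tables k m n := {ffun 'I_m -> {ffun bits k -> bits n}} (only parsing).

(* Positions are numbered from 0.  Words are plain sequences because derived
   keys are built one character at a time; a table family indexed by ['I_m] is
   only ever applied to a word with at least m characters. *)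
Definition simple_tab (k m n : nat) (T : tables k m n) (y : seq (bits k)) :
    bits n :=
  \sum_(j < m) T j y`_j.

(* The joint table space of (h_0, (h~_i)_i, h^); the uniform distribution on it
   makes all entries of all tables independent and uniform.  The component
   [i : 'I_d] of the second factor is h~_(i+1), which reads c + i characters. *)
Definition tornado_tables (k r c d : nat) : finType :=
  ((tables k c.-1 k * {dffun forall i : 'I_d, tables k (c + i) k})
     * tables k (c + d) r)%type.

Definition derived_key (k r c d : nat) (w : tornado_tables k r c d)
    (x : key k c) : seq (bits k) :=
  let x' := take c.-1 x in
  foldl (fun y (i : 'I_d) => rcons y (simple_tab (w.1.2 i) y))
    (rcons x' (x`_c.-1 + simple_tab w.1.1 x')) (enum 'I_d).

Definition tornado (k r c d : nat) (w : tornado_tables k r c d)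
    (x : key k c) : bits r :=
  simple_tab w.2 (derived_key w x).

(* The last derived character, in position c + d - 1. *)
Definition last_char (k r c d : nat) (w : tornado_tables k r c d)
    (x : key k c) : bits k :=
  (derived_key w x)`_(c + d).-1.

(* The random function x |-> (hbar[0](x), hbar[1](x)); its first component
   omits the table of the last derived character. *)
Definition hbar (k r c d : nat) (w : tornado_tables k r c d) :
    {ffun key k c -> bits r * bits k} :=
  [ffun x => (\sum_(j < c + d | (j < (c + d).-1)%N) w.2 j (derived_key w x)`_j,
              last_char w x)].

(* [phi x v] depends only on x and on the bits of v in positions B. *)
Definition is_selector (k r c : nat) (B : {set 'I_r})
    (phi : key k c -> bits r -> bool) : Prop :=
  forall x (v v' : bits r), {in B, v =1 v'} -> phi x v = phi x v'.

Definition selected (k r c d : nat) (phi : key k c -> bits r -> bool)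
    (w : tornado_tables k r c d) : {set key k c} :=
  [set x | phi x (tornado w x)].

Definition selected_at (k r c d : nat) (phi : key k c -> bits r -> bool)
    (w : tornado_tables k r c d) (alpha : bits k) : {set key k c} :=
  [set x in selected phi w | last_char w x == alpha].

Definition layer (k r c d : nat) (phi : key k c -> bits r -> bool) (i : nat)
    (w : tornado_tables k r c d) : nat :=
  #|[set alpha : bits k | (i <= #|selected_at phi w alpha|)%N]|.

Definition layer_le2 (k r c d : nat) (phi : key k c -> bits r -> bool)
    (w : tornado_tables k r c d) : nat :=
  (layer phi 1 w + layer phi 2 w)%N.

Definition position_chars (k m : nat) (y : seq (bits k)) :
    {set 'I_m * bits k} :=
  [set (i, y`_i) | i : 'I_m].

(* Subfamilies are sets of indices, so a family with a repeated key is
   dependent. *)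
Definition lin_indep (k m : nat) (I : finType) (A : {set I})
    (y : I -> seq (bits k)) : bool :=
  ~~ [exists Y : {set I},
        [&& Y \subset A, Y != set0 &
          [forall u : 'I_m * bits k,
             ~~ odd #|[set x in Y | u \in position_chars m (y x)]|]]].

Definition event_J (k r c d : nat) (phi : key k c -> bits r -> bool)
    (w : tornado_tables k r c d) : bool :=
  lin_indep (c + d).-1 (selected phi w) (derived_key w).

Definition Pr (R : realType) (Omega : finType) (E : pred Omega) : R :=
  #|E|%:R / #|Omega|%:R.

Definition Expect (R : realType) (Omega : finType) (Z : Omega -> R) : R :=
  (\sum_w Z w) / #|Omega|%:R.

(* Conditional expectation given the random object W, as a random variable:
   the average of Z over the fibre of W through w. *)
Definition cond_Expect (R : realType) (Omega : finType) (V : eqType)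
    (Z : Omega -> R) (W : Omega -> V) (w : Omega) : R :=
  (\sum_(w' | W w' == W w) Z w') / #|[pred w' | W w' == W w]|%:R.

Definition mean_selected (R : realType) (k r c d : nat)
    (phi : key k c -> bits r -> bool) : R :=
  Expect (fun w : tornado_tables k r c d => #|selected phi w|%:R).

Definition frac_selected (R : realType) (k r c d : nat)
    (phi : key k c -> bits r -> bool) : R :=
  mean_selected R d phi / #|{: bits k}|%:R.

Definition mubar (R : realType) (k r c d : nat)
    (phi : key k c -> bits r -> bool) (i : nat) : R :=
  #|{: bits k}|%:R * frac_selected R d phi ^+ i / i`!%:R.

(* Main.v *)
(* Condition on hbar.  The last table is then still uniform, so the sets X_alpha
   are independent over alpha, and S_1 + S_2 is the sum of the independent
   variables min(|X_alpha|, 2).  With a_2 = E[S_2 | hbar], their total variance is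
   at most mu + 2 (a_2 - mubar_2), and Bernstein's inequality gives the bound as
   soon as a_2 is at most mubar_2 + sqrt(3 ln(s_sec / p) mubar_2) + 1.

   To bound the probability that a_2 is larger, note that S_2 is a sum of
   independent indicators given hbar, so that S_2 >= floor(a_2) with conditional
   probability at least 1/2; this leaves the upper tail of S_2 itself.  On J the
   selected keys are hashed fully randomly, and expanding (1 + y)^S_2 over
   choices of a pair of keys in each X_alpha shows that its moment generating
   function there is at most that of a Poisson variable of mean mubar_2.

   The median bound for a sum of Bernoulli variables of integer mean m comes from
   replacing them one at a time by Poisson variables, which only increases
   Pr[S < m]; the Poisson case follows by reflecting the terms about m - 1/2. *)
Require Import Defs.
From HB Require Import structures.
From mathcomp Require Import all_boot all_order all_algebra.
From mathcomp Require Import boolp classical_sets topology normedtype.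
From mathcomp Require Import sequences derive realfun.
From mathcomp Require Import reals exp.
From mathcomp Require Import ring lra zify.

Set Implicit Arguments.
Unset Strict Implicit.
Unset Printing Implicit Defensive.

Import Order.TTheory GRing.Theory Num.Theory.
Import numFieldNormedType.Exports.
Local Open Scope ring_scope.

(** * Exponential inequalities *)

Lemma le_of_derive_ge0 (R : realType) (f df : R -> R) (a b : R) :
  a <= b -> (forall x, a <= x <= b -> is_derive x 1 f (df x)) ->
  (forall x, a < x < b -> 0 <= df x) -> f a <= f b.
Proof.
move=> ab fdf df0.
have cf : {within `[a, b], continuous f}%classic.
  apply: derivable_within_continuous => x; rewrite in_itv /= => xab.
  by have [] := fdf x xab.
have fd x : x \in `]a, b[ -> is_derive x 1 f (df x).
  by rewrite in_itv /= => /andP[ax xb]; apply: fdf; rewrite !ltW.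
move: ab; rewrite le_eqVlt => /orP[/eqP->//|ab].
have [c] := MVT ab fd cf; rewrite in_itv /= => cab e.
by rewrite -subr_ge0 e mulr_ge0 ?df0// subr_ge0 ltW.
Qed.

(** The derivative is [expR z - (1 + z)], which is nonnegative. *)
Lemma expR_taylor2_mono (R : realType) (x y : R) : x <= y ->
  expR x - (1 + x + x ^+ 2 / 2) <= expR y - (1 + y + y ^+ 2 / 2).
Proof.
move=> xy; pose q : {poly R} := 1 + 'X + 2^-1 *: 'X^2.
have qE z : q.[z] = 1 + z + z ^+ 2 / 2 by rewrite /q !hornerE /=; ring.
rewrite -!qE.
apply: (@le_of_derive_ge0 _ (fun z => expR z - q.[z])
  (fun z => expR z - (q^`()).[z])) => // z _.

rewrite /q !poly.derivE. rewrite !hornerE /= subr_ge0.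
have := expR_ge1Dx z; lra.
Qed.

Lemma expR_le_taylor2 (R : realType) (x : R) :
  x <= 0 -> expR x <= 1 + x + x ^+ 2 / 2.
Proof. by move=> /expR_taylor2_mono; rewrite expR0; lra. Qed.

Lemma expR_ge_taylor2 (R : realType) (x : R) :
  0 <= x -> 1 + x + x ^+ 2 / 2 <= expR x.
Proof. by move=> /expR_taylor2_mono; rewrite expR0; lra. Qed.

(** The quotient of the polynomials is the [2/1] Pade approximant of the exponential. After division
    by [expR z] the difference of the sides has derivative [(1 - expR (- z) * (1 + z + z ^+ 2 / 2))
    / 3]. *)
Lemma expR_pade (R : realType) (z : R) : 0 <= z ->
  (1 - z / 3) * expR z <= 1 + 2 / 3 * z + z ^+ 2 / 6.
Proof.
move=> z0; rewrite -ler_pdivlMr ?expR_gt0// -expRN.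
pose q : {poly R} := 1 + (2 / 3) *: 'X + 6^-1 *: 'X^2.
pose l : {poly R} := 1 - 3^-1 *: 'X.
have : q.[0] * expR (- 0) - l.[0] <= q.[z] * expR (- z) - l.[z].
  apply: (@le_of_derive_ge0 _ (fun x => q.[x] * expR (- x) - l.[x])
    (fun x => q^`().[x] * expR (- x) - q.[x] * expR (- x) - l^`().[x])) => //.
    by move=> x _; apply: is_derive_eq; rewrite /GRing.scale /=; ring.
  move=> x /andP[x0 _]; have := expR_ge_taylor2 (ltW x0).
  rewrite -(ler_pM2r (expR_gt0 (- x))) -expRD subrr expR0.
  rewrite /q /l !poly.derivE !hornerE /=; lra.
rewrite /q /l !hornerE /= oppr0 expR0; lra.
Qed.

(** For [z > 0] the case [b = z] is the Pade bound rewritten, and the right-hand side increases with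
    [b]. *)
Lemma expR_le_bernstein (R : realType) (b z : R) : z <= b -> 0 <= b -> b < 3 ->
  expR z <= 1 + z + z ^+ 2 / (2 * (1 - b / 3)).
Proof.
move=> zb b0 b3; have d0 : 0 < 1 - b / 3 by lra.
have [z0|z0] := leP z 0.
  apply: le_trans (expR_le_taylor2 z0) _; rewrite lerD2l.
  apply: ler_wpM2l; first exact: sqr_ge0.
  by rewrite lef_pV2 ?posrE; nra.
have e0 : 0 < 1 - z / 3 by lra.
have : expR z <= 1 + z + z ^+ 2 / (2 * (1 - z / 3)).
  have -> : 1 + z + z ^+ 2 / (2 * (1 - z / 3)) =
    (1 + 2 / 3 * z + z ^+ 2 / 6) / (1 - z / 3) by field; lra.
  by rewrite ler_pdivlMr// mulrC expR_pade// ltW.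
move/le_trans; apply; rewrite lerD2l.
by apply: ler_wpM2l; rewrite ?sqr_ge0// lef_pV2 ?posrE; nra.
Qed.

(** Numerically 2.718 against 2.732: (33/20)^2 = 2.7225 is below 1 + 19/11. *)
Lemma expR1_lt_1Dsqrt3 (R : realType) : expR 1 < 1 + Num.sqrt 3 :> R.
Proof.
have h : expR (1 / 2) <= 33 / 20 :> R.
  have h0 : 0 <= 1 / 2 :> R by lra.
  have := expR_pade h0; rewrite expr2; move: (expR _) => e.
  have -> : 1 - 1 / 2 / 3 = 5 / 6 :> R by field.
  have -> : 1 + 2 / 3 * (1 / 2) + 1 / 2 * (1 / 2) / 6 = 33 / 24 :> R by field.
  lra.
have s3 : 19 / 11 <= Num.sqrt 3 :> R.
  have := sqrtr_ge0 (3 : R); have : Num.sqrt 3 ^+ 2 = 3 :> R by rewrite sqr_sqrtr.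
  by nra.
have -> : expR 1 = expR (1 / 2) * expR (1 / 2) :> R.
  by rewrite -expRD; congr expR; field.
apply: (@le_lt_trans _ _ (33 / 20 * (33 / 20))); last by lra.
by rewrite ler_pM ?expR_ge0.
Qed.

(** The Poisson Chernoff exponent. With [v = 1 + x], division by [v] turns the claim into
    [1 / 3 <= l v]. As [l] increases up to 2 and decreases afterwards, only the endpoints count:
    equality holds at [v = 1], and at [v = 1 + Num.sqrt 3] the claim is [1 <= ln v]. *)
Lemma ln_ge_rational (R : realType) (x : R) : 0 <= x -> x <= Num.sqrt 3 ->
  x ^+ 2 / 3 <= (1 + x) * ln (1 + x) - x.
Proof.
move=> x0 x3.
pose l (v : R) := ln v - 3^-1 * v + (2 / 3) * v^-1.
pose dl (v : R) := v^-1 - 3^-1 - (2 / 3) * v ^- 2.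
have dlE v : 0 < v -> dl v = (2 - v) * (v - 1) / (3 * v ^+ 2).
  by move=> v0; rewrite /dl; field; lra.
have lD (v : R) : 0 < v -> is_derive v 1 l (dl v).
  move=> v0; have vN0 : v != 0 by rewrite gt_eqF.
  have d1 := is_derive1_ln v0.
  have d2 : is_derive v 1 (fun y : R => y^-1) (- v ^- 2 *: 1).
    exact: is_deriveV vN0 (is_derive_id v 1).
  rewrite /l; apply: is_derive_eq; rewrite /dl /GRing.scale /=; ring.
have l1 : l 1 = 1 / 3 by rewrite /l ln1 invr1; lra.
suff l_ge : 1 / 3 <= l (1 + x).
  have v0 : 0 < 1 + x by lra.
  have : (1 + x) * (1 / 3) <= (1 + x) * l (1 + x) by rewrite ler_pM2l.
  rewrite /l.
  have -> : (1 + x) * (ln (1 + x) - 3^-1 * (1 + x) + 2 / 3 * (1 + x)^-1) =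
    (1 + x) * ln (1 + x) - 3^-1 * (1 + x) ^+ 2 + 2 / 3 by field; lra.
  lra.
have [x1|x1] := leP x 1.
  rewrite -l1; apply: (@le_of_derive_ge0 _ l dl); first by lra.
    by move=> v /andP[v1 _]; apply: lD; lra.
  move=> v /andP[v1 v2]; rewrite dlE; last by lra.
  by rewrite divr_ge0 ?mulr_ge0 ?exprn_ge0//; lra.
have s3 : Num.sqrt 3 ^+ 2 = 3 :> R by rewrite sqr_sqrtr.
have s0 : 0 <= Num.sqrt 3 :> R by exact: sqrtr_ge0.
apply: (@le_trans _ _ (l (1 + Num.sqrt 3))).
  have ln1s : 1 <= ln (1 + Num.sqrt 3) :> R.
    by rewrite -ler_expR lnK ?posrE ?ltr_wpDr// ltW// expR1_lt_1Dsqrt3.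
  rewrite /l; have -> : (1 + Num.sqrt 3)^-1 = (Num.sqrt 3 - 1) / 2 :> R.
    have e : (1 + Num.sqrt 3) * ((Num.sqrt 3 - 1) / 2) = 1 :> R by lra.
    have s10 : 1 + Num.sqrt 3 != 0 :> R by rewrite gt_eqF// ltr_wpDr.
    by rewrite -[LHS]mulr1; symmetry; apply: canRL (mulKf s10) e.
  lra.
rewrite -lerN2; apply: (@le_of_derive_ge0 _ (fun v => - l v) (fun v => - dl v)).
- by lra.
- move=> v /andP[v1 _]; have v0 : 0 < v by lra.
  exact: is_deriveN (lD v v0).
move=> v /andP[v1 v2]; rewrite dlE; last by lra.
rewrite oppr_ge0 -mulrA mulr_le0_ge0//; first by lra.
by rewrite divr_ge0 ?mulr_ge0 ?exprn_ge0//; lra.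
Qed.

(** * The median of a Poisson binomial variable *)

(** If [g] is the law of Z, this is the law of Z + 1. *)
Definition lag (R : nmodType) (g : nat -> R) (j : nat) : R :=
  if j is j'.+1 then g j' else 0.

(* The law of a Poisson variable of mean [lam] plus independent Bernoulli
   variables with the parameters listed in [ps]. *)
Fixpoint pbin (R : realType) (lam : R) (ps : seq R) (j : nat) : R :=
  if ps is p :: ps' then (1 - p) * pbin lam ps' j + p * lag (pbin lam ps') j
  else expR (- lam) * lam ^+ j / j`!%:R.

(** Strict: the probability of falling below [m]. *)
Definition pbin_cdf (R : realType) (lam : R) (ps : seq R) (m : nat) : R :=
  \sum_(j < m) pbin lam ps j.

Definition unit_seq (R : realType) (ps : seq R) := all (fun p => 0 <= p <= 1) ps.

Section PoissonBinomial.
Variable R : realType.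
Implicit Types (lam p : R) (ps : seq R).

Lemma pbin_ge0 lam ps j : 0 <= lam -> unit_seq ps -> 0 <= pbin lam ps j.
Proof.
move=> lam0; elim: ps j => [|p ps IH] j /=.
  by move=> _; rewrite divr_ge0 ?mulr_ge0 ?expR_ge0 ?exprn_ge0.
move=> /andP[/andP[p0 p1] ups]; rewrite addr_ge0// mulr_ge0 ?subr_ge0 ?IH//.
by case: j => //= j; exact: IH.
Qed.

Lemma pbin_cons lam p ps j :
  pbin lam (p :: ps) j = (1 - p) * pbin lam ps j + p * lag (pbin lam ps) j.
Proof. by []. Qed.

Lemma eq_pbin_cons lam p ps ps' : pbin lam ps =1 pbin lam ps' ->
  pbin lam (p :: ps) =1 pbin lam (p :: ps').
Proof. by move=> e [|j] /=; rewrite !e. Qed.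

Lemma pbin_swap lam p q ps : pbin lam [:: p, q & ps] =1 pbin lam [:: q, p & ps].
Proof. by move=> [|[|j]] /=; ring. Qed.

Lemma pbin_cat_cons lam p ps qs :
  pbin lam (ps ++ p :: qs) =1 pbin lam (p :: ps ++ qs).
Proof.
elim: ps => [//|q ps IH] j; rewrite cat_cons (eq_pbin_cons q IH).
exact: pbin_swap.
Qed.

Lemma pbin_perm lam ps qs : perm_eq ps qs -> pbin lam ps =1 pbin lam qs.
Proof.
elim: ps qs => [|p ps IH] qs; first by rewrite perm_sym => /perm_nilP ->.
move=> pq; have : p \in qs by rewrite -(perm_mem pq) mem_head.
move=> /path.splitPr qsE; case: qsE pq => q1 q2.
rewrite perm_sym perm_catC /= perm_cons perm_catC perm_sym => /IH e j.
by rewrite pbin_cat_cons; apply: eq_pbin_cons.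
Qed.

Lemma pbin_rem lam p ps j : p \in ps ->
  pbin lam ps j =
  (1 - p) * pbin lam (rem p ps) j + p * lag (pbin lam (rem p ps)) j.
Proof. by move=> /perm_to_rem/pbin_perm ->. Qed.

Lemma lag_pbin_cons lam p ps j : lag (pbin lam (p :: ps)) j =
  (1 - p) * lag (pbin lam ps) j + p * lag (lag (pbin lam ps)) j.
Proof. by case: j => [|j] /=; rewrite ?mulr0 ?addr0. Qed.

(** Size biasing: in E[S; S = j + 1] each Bernoulli [p] contributes [p] times the probability that
    the rest sums to [j], and the Poisson part contributes [lam] times the probability of [j]. *)
Lemma pbin_stein lam ps j : j.+1%:R * pbin lam ps j.+1 =
  lam * pbin lam ps j + \sum_(p <- ps) p * pbin lam (rem p ps) j.
Proof.
elim: ps j => [|q ps IH] j.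
  rewrite big_nil addr0 /= exprS factS natrM invfM.
  have : j.+1%:R != 0 :> R by rewrite pnatr_eq0.
  have : j`!%:R != 0 :> R by rewrite pnatr_eq0 -lt0n fact_gt0.
  by move: j`!%:R j.+1%:R => a b a0 b0; field; apply/andP.
rewrite big_cons /= eqxx.
have -> : \sum_(p <- ps) p * pbin lam (rem p (q :: ps)) j =
    (1 - q) * (\sum_(p <- ps) p * pbin lam (rem p ps) j) +
    q * (\sum_(p <- ps) p * lag (pbin lam (rem p ps)) j).
  rewrite !mulr_sumr -big_split; apply: eq_big_seq => p pps /=.
  have [->|_] := eqVneq q p; last by rewrite pbin_cons; ring.
  by rewrite (pbin_rem _ _ pps); ring.
have -> : j.+1%:R * ((1 - q) * pbin lam ps j.+1 + q * pbin lam ps j) =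
    (1 - q) * (j.+1%:R * pbin lam ps j.+1) + q * pbin lam ps j
    + q * (j%:R * pbin lam ps j) by rewrite -natr1; ring.
rewrite IH; have -> : j%:R * pbin lam ps j =
    lam * lag (pbin lam ps) j + \sum_(p <- ps) p * lag (pbin lam (rem p ps)) j.
  case: j => [|j]; last exact: IH.
  by rewrite mul0r mulr0 add0r big1// => p _; rewrite mulr0.
by ring.
Qed.

Lemma unit_seq_rem p ps : unit_seq ps -> unit_seq (rem p ps).
Proof. by move=> /allP u; apply/allP => x /mem_rem; exact: u. Qed.

Lemma sum_rem p ps : p \in ps ->
  \sum_(q <- rem p ps) q = \sum_(q <- ps) q - p.
Proof. by move=> /perm_to_rem e; rewrite (perm_big _ e) big_cons addrAC subrr add0r. Qed.

(* Darroch's rule on the mode.  By Stein's identity, j f(j) - M f(j - 1) is the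
   sum of p^2 (f_p(j - 1) - f_p(j - 2)), where M is the mean and f_p omits one
   Bernoulli p, so that its mean is still at least j - 1. *)
Lemma lag_pbin_le lam ps j : 0 <= lam -> unit_seq ps ->
  j%:R <= lam + \sum_(p <- ps) p -> lag (pbin lam ps) j <= pbin lam ps j.
Proof.
move=> lam0; move: {2}(size ps) (leqnn (size ps)) j => n.
elim: n ps => [|n IH] ps sz [|j] ups M //=; try exact: pbin_ge0.
  move: sz; rewrite leqn0 => /nilP ps0; move: M; rewrite {}ps0 big_nil addr0 => M.
  have := pbin_stein lam [::] j; rewrite big_nil addr0 => e.
  have j0 : 0 < j.+1%:R :> R by [].
  by rewrite -(ler_pM2l j0) e ler_wpM2r// pbin_ge0.
have j0 : 0 < j.+1%:R :> R by [].
rewrite -(ler_pM2l j0) pbin_stein.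
apply: (@le_trans _ _ ((lam + \sum_(p <- ps) p) * pbin lam ps j)).
  by rewrite ler_wpM2r// pbin_ge0.
rewrite mulrDl lerD2l mulr_suml big_seq [leRHS]big_seq; apply: ler_sum => p pps.
have /andP[p0 p1] := allP ups p pps; rewrite ler_wpM2l//.
rewrite (pbin_rem _ _ pps).
have : lag (pbin lam (rem p ps)) j <= pbin lam (rem p ps) j.
  apply: IH; rewrite ?unit_seq_rem//.
    by rewrite size_rem//; case: (ps) pps sz.
  by rewrite sum_rem//; move: M; rewrite -natr1; lra.
nra.
Qed.

Lemma pbin_cdf_cons lam p ps m :
  pbin_cdf lam (p :: ps) m = pbin_cdf lam ps m - p * lag (pbin lam ps) m.
Proof.
rewrite /pbin_cdf; elim: m => [|m IH]; first by rewrite !big_ord0 /= mulr0 subr0.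
by rewrite !big_ord_recr IH /=; ring.
Qed.

(** To first order, raising the Poisson mean by dx adds 1 to the variable with probability dx. *)
Lemma is_derive_pbin ps j lam : is_derive lam 1 (fun x => pbin x ps j)
  (lag (pbin lam ps) j - pbin lam ps j).
Proof.
elim: ps j => [|p ps IH] j.
  pose q : {poly R} := j`!%:R^-1 *: 'X^j.
  rewrite (_ : (fun x => _) = (fun x => expR (- x) * q.[x])); last first.
    by apply/funext => x; rewrite /q !hornerE /=; ring.
  apply: is_derive_eq; rewrite /q !poly.derivE !hornerE /= /GRing.scale /=.
  case: j @q => [|j] _ /=; first by rewrite expr0 mulr0n horner0; ring.
  rewrite hornerMn !hornerE /= factS natrM invfM.
  have : j.+1%:R != 0 :> R by rewrite pnatr_eq0.
  have : j`!%:R != 0 :> R by rewrite pnatr_eq0 -lt0n fact_gt0.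
  rewrite -(mulr_natl (lam ^+ j)) exprS.
  by move: j`!%:R j.+1%:R => a b a0 b0; field; apply/andP.
rewrite lag_pbin_cons /=; have d1 := IH j.
have d2 : is_derive lam 1 (fun x => lag (pbin x ps) j)
    (lag (lag (pbin lam ps)) j - lag (pbin lam ps) j).
  case: j {d1} => [|j] /=; last exact: IH.
  by rewrite subr0; exact: is_derive_cst.
by apply: is_derive_eq; rewrite /GRing.scale /=; ring.
Qed.

Lemma is_derive_pbin_cdf ps m lam : is_derive lam 1 (fun x => pbin_cdf x ps m)
  (- lag (pbin lam ps) m).
Proof.
rewrite /pbin_cdf; elim: m => [|m IH].
  under eq_fun do rewrite big_ord0.
  by rewrite oppr0; exact: is_derive_cst.
under eq_fun do rewrite big_ord_recr /=.
have d := is_derive_pbin ps m lam.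
by apply: is_derive_eq; rewrite /=; ring.
Qed.

(** [psi u] is the probability of falling below the threshold when the Poisson part has mean [u] and
    the Bernoulli has parameter [lam + p - u], so that the total mean stays fixed. Its derivative
    has the sign given by the mode rule. *)
Lemma pbin_cdf_poissonize lam p ps m : 0 <= lam -> 0 <= p <= 1 ->
  unit_seq ps -> m%:R <= lam + p + \sum_(q <- ps) q ->
  pbin_cdf lam (p :: ps) m <= pbin_cdf (lam + p) ps m.
Proof.
move=> lam0 /andP[p0 p1] ups; case: m => [|m] M; first by rewrite /pbin_cdf !big_ord0.
pose psi u := pbin_cdf u ps m.+1 - (lam + p - u) * pbin u ps m.
have -> : pbin_cdf lam (p :: ps) m.+1 = psi lam.
  by rewrite pbin_cdf_cons /psi /=; ring.
have -> : pbin_cdf (lam + p) ps m.+1 = psi (lam + p).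
  by rewrite /psi /= subrr mul0r subr0.
apply: (@le_of_derive_ge0 _ psi
  (fun u => (lam + p - u) * (pbin u ps m - lag (pbin u ps) m))).
- by rewrite lerDl.
- move=> u _; have d1 := is_derive_pbin ps m u.
  have d2 := is_derive_pbin_cdf ps m.+1 u.
  by rewrite /psi; apply: is_derive_eq; rewrite /GRing.scale /=; ring.
move=> u /andP[u1 u2]; rewrite mulr_ge0//; first by rewrite subr_ge0 ltW.
rewrite subr_ge0 lag_pbin_le//; first exact: le_trans lam0 (ltW u1).
(* Leaving out the Bernoulli costs at most 1 in the mean, which the step from [m.+1] to [m] pays
   for. *)
by move: M; rewrite -natr1; lra.
Qed.

Lemma poisson_partial_sum_le1 lam m : 0 <= lam -> pbin_cdf lam [::] m <= 1.
Proof.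
move=> lam0; rewrite /pbin_cdf /=; under eq_bigr do rewrite -mulrA.
rewrite -mulr_sumr expRN mulrC ler_pdivrMr ?expR_gt0// mul1r.
have := @nondecreasing_cvgn_le R (series (exp_coeff lam)).
move=> /(_ _ (is_cvg_series_exp_coeff lam) m).
rewrite /series /= big_mkord; apply.
by apply/nondecreasing_seqP => n; rewrite big_nat_recr//= lerDl exp_coeff_ge0.
Qed.

Lemma poisson_reflect_le lam m i : m%:R <= lam -> (i < m)%N ->
  pbin lam [::] (m.-1 - i) <= pbin lam [::] (m + i).
Proof.
move=> mlam; elim: i => [|i IH] im.
  rewrite subn0 addn0; case: m mlam im => // m mlam _.
  rewrite [X in X <= _](_ : _ = lag (pbin lam [::]) m.+1)//.
  apply: lag_pbin_le => //; first exact: le_trans mlam.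
  by rewrite big_nil addr0.
have lam0 : 0 < lam by apply: lt_le_trans mlam; rewrite ltr0n (leq_trans _ im).
have := pbin_stein lam [::] (m.-1 - i.+1); have := pbin_stein lam [::] (m + i).
rewrite !big_nil !addr0 -addnS => e1 e2.
have sE : (m.-1 - i.+1).+1 = (m.-1 - i)%N by lia.
rewrite sE in e2; have := IH (ltnW im) => {}IH.
have mi0 : 0 < (m + i.+1)%:R :> R by rewrite ltr0n addnS.
rewrite -(ler_pM2l lam0) -e2 -(ler_pM2l mi0).
rewrite [leRHS](_ : _ = lam * (lam * pbin lam [::] (m + i))); last by rewrite -e1; ring.
rewrite [leLHS]mulrA [leRHS]mulrA; apply: ler_pM => //.
- by rewrite mulr_ge0.
- by apply: pbin_ge0 => //; exact: ltW.
(* The product of the two ratios is governed by (m + i + 1)(m - 1 - i) = m^2 - (i + 1)^2. *)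
apply: (@le_trans _ _ (m%:R * m%:R)); last by rewrite ler_pM.
by rewrite -!natrM ler_nat; nia.
Qed.

Lemma poisson_median lam m : m%:R <= lam -> pbin_cdf lam [::] m <= 1 / 2.
Proof.
move=> mlam; have lam0 : 0 <= lam by exact: le_trans mlam.
suff : pbin_cdf lam [::] m + pbin_cdf lam [::] m <= 1 by lra.
apply: le_trans (poisson_partial_sum_le1 (m + m) lam0).
rewrite {3}/pbin_cdf big_split_ord /= lerD2l /pbin_cdf.
rewrite (reindex_inj rev_ord_inj) /=; apply: ler_sum => i _.
by rewrite (_ : (m - i.+1)%N = (m.-1 - i)%N); [exact: poisson_reflect_le|lia].
Qed.

Lemma pbin_median_aux lam ps m : 0 <= lam -> unit_seq ps ->
  m%:R <= lam + \sum_(p <- ps) p -> pbin_cdf lam ps m <= 1 / 2.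
Proof.
elim: ps lam => [|p ps IH] lam lam0.
  by rewrite big_nil addr0 => _; exact: poisson_median.
move=> /andP[p01 ups]; rewrite big_cons addrA => M.
apply: le_trans (pbin_cdf_poissonize lam0 p01 ups M) _.
by apply: IH => //; rewrite addr_ge0//; case/andP: p01.
Qed.

Lemma pbin_median ps m : unit_seq ps -> m%:R <= \sum_(p <- ps) p ->
  pbin_cdf 0 ps m <= 1 / 2.
Proof. by move=> ups M; apply: pbin_median_aux; rewrite ?add0r. Qed.

(** At mean 0 the Poisson factor is the point mass at 0. *)
Lemma coef_prod_bernoulli ps j :
  (\prod_(p <- ps) ((1 - p)%:P + p *: 'X))`_j = pbin 0 ps j.
Proof.
elim: ps j => [|p ps IH] j.
  rewrite big_nil coef1 /= oppr0 expR0 mul1r expr0n.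
  by case: j => [|j] /=; rewrite ?fact0 ?divr1 ?mul0r.
rewrite big_cons mulrDl coefD coefCM -scalerAl coefZ coefXM !IH /=.
by case: j => [|j] /=; rewrite ?IH.
Qed.

End PoissonBinomial.

(** * Finite expectations and product spaces *)

Section FiniteExpectation.
Variables (R : realType) (Omega : finType).
Implicit Types Y Z : Omega -> R.

Lemma sum_indicator (E : pred Omega) : \sum_w (E w)%:R = #|E|%:R :> R.
Proof.
rewrite -sum1_card natr_sum [RHS]big_mkcond.
by apply: eq_bigr => w _; rewrite unfold_in; case: (E w).
Qed.

Lemma PrE (E : pred Omega) : Pr R E = Expect (fun w => (E w)%:R).
Proof. by rewrite /Expect sum_indicator. Qed.

Lemma eq_Expect Y Z : Y =1 Z -> Expect Y = Expect Z.
Proof. by move=> e; congr (_ / _); apply: eq_bigr => w _; rewrite e. Qed.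

Lemma le_Expect Y Z : (forall w, Y w <= Z w) -> Expect Y <= Expect Z.
Proof. by move=> le; rewrite ler_wpM2r ?invr_ge0// ler_sum. Qed.

Lemma Expect_ge0 Z : (forall w, 0 <= Z w) -> 0 <= Expect Z.
Proof. by move=> Z0; rewrite divr_ge0 ?sumr_ge0. Qed.

Lemma ExpectD Y Z : Expect (fun w => Y w + Z w) = Expect Y + Expect Z.
Proof. by rewrite /Expect big_split mulrDl. Qed.

Lemma ExpectZ a Z : Expect (fun w => a * Z w) = a * Expect Z.
Proof. by rewrite /Expect -mulr_sumr mulrA. Qed.

Lemma Expect_sum (I : finType) (Q : pred I) (Z : I -> Omega -> R) :
  Expect (fun w => \sum_(i | Q i) Z i w) = \sum_(i | Q i) Expect (Z i).
Proof. by rewrite /Expect exchange_big mulr_suml. Qed.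

Lemma Expect_cst a : (0 < #|Omega|)%N -> Expect (fun _ : Omega => a : R) = a.
Proof.
move=> O0; rewrite /Expect sumr_const -[a *+ _]mulr_natr mulfK// pnatr_eq0.
by rewrite -lt0n.
Qed.

Lemma lt_Expect Y Z : (0 < #|Omega|)%N -> (forall w, Y w < Z w) ->
  Expect Y < Expect Z.
Proof.
move=> O0 lt; rewrite ltr_pM2r ?invr_gt0 ?ltr0n//.
apply: ltr_sum => [|w _]; last exact: lt.
by have /card_gt0P[w _] := O0; apply/hasP; exists w; rewrite ?mem_index_enum.
Qed.

Lemma Pr_ge0 (E : pred Omega) : 0 <= Pr R E.
Proof. by rewrite divr_ge0. Qed.

Lemma Pr_le1 (E : pred Omega) : Pr R E <= 1.
Proof.
rewrite /Pr; have [->|O0] := eqVneq #|Omega| 0%N; first by rewrite invr0 mulr0.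
by rewrite ler_pdivrMr ?ltr0n ?lt0n// mul1r ler_nat max_card.
Qed.

Lemma Pr_le_split (E F : pred Omega) :
  Pr R E <= Expect (fun w => (E w)%:R * (~~ F w)%:R) + Expect (fun w => (F w)%:R).
Proof.
rewrite PrE -ExpectD; apply: le_Expect => w.
by case: (E w); case: (F w); rewrite /= ?mul1r ?mul0r ?addr0 ?add0r.
Qed.

End FiniteExpectation.

(** * Bernstein's inequality and the median bound for independent coordinates *)

Section ProductSpace.
Variables (R : realType) (I B : finType).
Hypothesis B_gt0 : (0 < #|B|)%N.

Lemma card_ffun_gt0 : (0 < #|{ffun I -> B}|)%N.
Proof. by rewrite card_ffun expn_gt0 B_gt0. Qed.

Lemma Expect_prod (G : I -> B -> R) :
  Expect (fun T : {ffun I -> B} => \prod_i G i (T i)) = \prod_i Expect (G i).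
Proof.
rewrite /Expect big_split /= bigA_distr_bigA /= card_ffun prodr_const.
by rewrite exprVn natrX.
Qed.

Lemma Expect_coord (i : I) (g : B -> R) :
  Expect (fun T : {ffun I -> B} => g (T i)) = Expect g.
Proof.
have := Expect_prod (fun j b => if j == i then g b else 1).
rewrite (bigD1 i)//= eqxx big1 ?mulr1; last first.
  by move=> j /negbTE ->; rewrite Expect_cst.
move=> <-; apply: eq_Expect => T; rewrite (bigD1 i)//= eqxx big1 ?mulr1//.
by move=> j /negbTE ->.
Qed.

(* The subgamma form of Bernstein's inequality: with s = sqrt(2 L / V) the
   exponent lam = s / (1 + 2 s / 3) is optimal. *)
Lemma bernstein_lower_tail (Y : I -> B -> R) (V L : R) :
  (forall i b, 0 <= Y i b <= 2) -> 0 < L ->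
  \sum_i (Expect (fun b => Y i b ^+ 2) - Expect (Y i) ^+ 2) < V ->
  Expect (fun T : {ffun I -> B} =>
    (\sum_i Y i (T i) <= \sum_i Expect (Y i) - Num.sqrt (2 * L * V)
       - 2 / 3 * L)%R%:R) < expR (- L).
Proof.
move=> Y02 L0; set v := \sum_i _ => vV.
pose m i := Expect (Y i).
have varE i : Expect (fun b => (m i - Y i b) ^+ 2) =
    Expect (fun b => Y i b ^+ 2) - m i ^+ 2.
  rewrite (@eq_Expect _ _ _ (fun b => (m i ^+ 2 + (- 2 * m i) * Y i b) + Y i b ^+ 2)).
    by rewrite !ExpectD Expect_cst// ExpectZ -/(m i); ring.
  by move=> b; ring.
have v0 : 0 <= v.
  by apply: sumr_ge0 => i _; rewrite -varE Expect_ge0// => b; exact: sqr_ge0.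
have V0 : 0 < V by exact: le_lt_trans vV.
pose s := Num.sqrt (2 * L / V).
have s0 : 0 < s by rewrite sqrtr_gt0 !mulr_gt0 ?invr_gt0.
have s2V : s ^+ 2 * V = 2 * L.
  by rewrite sqr_sqrtr ?divfK ?gt_eqF// divr_ge0 ?mulr_ge0 ?ltW.
have sV : Num.sqrt (2 * L * V) = s * V.
  rewrite -[LHS]ger0_norm ?sqrtr_ge0//.
  apply/eqP; rewrite -(@eqrXn2 _ 2)//; last by rewrite mulr_ge0 ?ltW.
  rewrite ger0_norm ?sqrtr_ge0// sqr_sqrtr; last by rewrite !mulr_ge0 ?ltW.
  by rewrite exprMn [V ^+ 2]expr2 mulrA s2V.
pose D := 1 + 2 / 3 * s; have D0 : 0 < D by rewrite /D; lra.
pose lam := s / D.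
have lamD : lam * D = s by rewrite /lam divfK// gt_eqF.
have lam0 : 0 < lam by rewrite divr_gt0.
have lam3 : 2 * lam < 3 by rewrite /D in lamD; nra.
(* By the choice of [D], [D - 2 / 3 * s = 1]. *)
have Dinv : (1 - 2 * lam / 3) = D^-1.
  apply: (@mulIf _ D); first by rewrite gt_eqF.
  by rewrite mulVf ?gt_eqF// mulrBl mul1r mulrAC -(mulrA 2) lamD /D; field.
pose K := lam ^+ 2 / (2 * (1 - 2 * lam / 3)).
pose t := s * V + 2 / 3 * L.
have KE : K = lam * s / 2.
  by rewrite /K Dinv expr2 -lamD; field; rewrite gt_eqF.
(* Markov's inequality for the exponential of [lam] times the deviation below the mean. *)
apply: (@le_lt_trans _ _ (Expect (fun T : {ffun I -> B} =>
    expR (- (lam * t)) * \prod_i expR (lam * (m i - Y i (T i)))))).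
  apply: le_Expect => T; rewrite -expR_sum -expRD.
  case: (leP (\sum_i Y i (T i)) _) => [le|_]; last exact: expR_ge0.
  rewrite -expR0 ler_expR -mulr_sumr -mulrN -mulrDr mulr_ge0 ?(ltW lam0)// sumrB /t.
  have mE : \sum_i m i = \sum_i Expect (Y i) by [].
  by move: le; rewrite sV mE; lra.
rewrite ExpectZ (Expect_prod (fun i b => expR (lam * (m i - Y i b)))).
apply: (@le_lt_trans _ _ (expR (- (lam * t)) * expR (K * v))).
  rewrite ler_pM2l ?expR_gt0// /v mulr_sumr expR_sum; apply: ler_prod => i _.
  rewrite Expect_ge0 => [|b]; last exact: expR_ge0.
  apply: le_trans (expR_ge1Dx _); rewrite /= -varE.
  apply: (@le_trans _ _ (Expect (fun b =>
      (1 + lam * m i) + (- lam) * Y i b + K * (m i - Y i b) ^+ 2))).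
    apply: le_Expect => b; have /andP[y0 y2] := Y02 i b.
    have m2 : m i <= 2.
      rewrite -[leRHS](@Expect_cst R B 2)//; apply: le_Expect => b'.
      by case/andP: (Y02 i b').
    have := @expR_le_bernstein R (2 * lam) (lam * (m i - Y i b)).
    move=> /(_ _ _ lam3) le; apply: le_trans (le _ _) _.
    - by rewrite [2 * _]mulrC ler_wpM2l ?(ltW lam0)//; lra.
    - by rewrite mulr_ge0 ?ltW.
    by rewrite /K exprMn; lra.
  rewrite 2!ExpectD Expect_cst// !ExpectZ -/(m i); lra.
rewrite -expRD ltr_expR KE.
(* The strictness of the conclusion comes from [v < V]. *)
apply: (@lt_le_trans _ _ (- (lam * t) + lam * s / 2 * V)).
  have c0 : 0 < lam * s / 2 by rewrite divr_gt0// mulr_gt0.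
  by rewrite ltrD2l ltr_pM2l.
have -> : lam * s / 2 * V = lam * (s * V) / 2 by ring.
have e : lam * (s * V) = 2 * L - 4 / 3 * L * lam.
  have : lam * D * (s * V) = 2 * L by rewrite lamD mulrA -expr2.
  have : lam * s * (s * V) = lam * (2 * L) by rewrite -s2V; ring.
  by rewrite /D; lra.
by rewrite /t mulrDr; lra.
Qed.

(** The generating function of the count is the product of those of the coordinates, which
    identifies its law as [pbin 0 ps]. *)
Lemma poisson_binomial_median (Z : I -> B -> bool) (m : nat) :
  m%:R <= \sum_i Expect (fun b => (Z i b)%:R : R) ->
  1 / 2 <= Expect (fun T : {ffun I -> B} =>
    (m <= \sum_i Z i (T i))%N%:R : R).
Proof.
move=> M; pose p i := Expect (fun b => (Z i b)%:R : R).
pose ps := [seq p i | i <- index_enum I].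
have B0 : #|B|%:R != 0 :> R by rewrite pnatr_eq0 -lt0n.
have upsP : unit_seq ps.
  apply/allP => _ /mapP[i _ ->]; rewrite Expect_ge0//=.
  rewrite -[leRHS](@Expect_cst R B 1)//; apply: le_Expect => b.
  by case: (Z i b).
have sumZ i : \sum_b 'X^(Z i b) = #|B|%:R *: ((1 - p i)%:P + p i *: 'X) :> {poly R}.
  have pE : \sum_b (Z i b)%:R = #|B|%:R * p i by rewrite mulrC /p /Expect divfK.
  rewrite (eq_bigr (fun b => (1 - (Z i b)%:R)%:P + (Z i b)%:R *: 'X)); last first.
    move=> b _; case: (Z i b); rewrite ?subrr ?scale1r ?add0r//.
    by rewrite subr0 scale0r addr0.
  rewrite big_split /= -scaler_suml -rmorph_sum /= pE sumrB pE sumr_const.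
  rewrite scalerDr scalerA; congr (_ + _).
  by rewrite -mul_polyC -polyCM mulrBr mulr1.
have count j : \sum_(T : {ffun I -> B}) ((\sum_i Z i (T i))%N == j)%:R =
    #|{ffun I -> B}|%:R * pbin 0 ps j.
  have : (\prod_i \sum_b 'X^(Z i b) : {poly R}) =
      \sum_(T : {ffun I -> B}) \prod_i 'X^(Z i (T i)).
    exact: bigA_distr_bigA.
  move=> /(congr1 (fun q : {poly R} => q`_j)).
  rewrite (eq_bigr _ (fun i _ => sumZ i)) scaler_prod coefZ.
  rewrite prodr_const -natrX -card_ffun -(big_map p predT (fun q => (1 - q)%:P + q *: 'X)).
  rewrite coef_prod_bernoulli => ->; rewrite coef_sum; apply: eq_bigr => T _.
  by rewrite prodrXr coefXn eq_sym.
have F0 : 0 < #|{ffun I -> B}|%:R :> R by rewrite ltr0n card_ffun_gt0.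
have : Expect (fun T : {ffun I -> B} => (\sum_i Z i (T i) < m)%N%:R : R) <= 1 / 2.
  have := @pbin_median R ps m upsP; rewrite big_map => /(_ M).
  apply: le_trans; rewrite /Expect ler_pdivrMr// mulrC /pbin_cdf mulr_sumr.
  under [leRHS]eq_bigr do rewrite -count.
  rewrite exchange_big /=; apply: ler_sum => T _.
  have [lt|//] := ltnP; last by rewrite sumr_ge0.
  by rewrite (bigD1 (Ordinal lt))//= eqxx lerDl sumr_ge0.
have : Expect (fun T : {ffun I -> B} =>
    (\sum_i Z i (T i) < m)%N%:R + (m <= \sum_i Z i (T i))%N%:R : R) = 1.
  rewrite -[RHS](@Expect_cst R {ffun I -> B} 1) ?card_ffun_gt0//.
  by apply: eq_Expect => T; have [] := ltnP; rewrite ?addr0 ?add0r.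
by rewrite ExpectD; lra.
Qed.

End ProductSpace.

(** * Full randomness on linearly independent derived keys *)

Section Resampling.
Variables (R : realType) (Omega F : finType).
Variables (upd : Omega -> F -> Omega) (coord : Omega -> F).
Hypothesis coord_upd : forall w t, coord (upd w t) = t.
Hypothesis upd_upd : forall w t t', upd (upd w t) t' = upd w t'.
Hypothesis upd_coord : forall w, upd w (coord w) = w.

(** Swapping the old coordinate of [w] with the fresh value [t] is an involution of [Omega * F]. *)
Lemma sum_resample (P : pred Omega) (G : Omega -> R) :
  (forall w t, P (upd w t) = P w) -> (0 < #|F|)%N ->
  \sum_(w | P w) G w = \sum_(w | P w) Expect (fun t => G (upd w t)).
Proof.
move=> Pupd F0; rewrite /Expect -mulr_suml; apply/esym.
rewrite pair_big_dep /=.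
pose h (z : Omega * F) := (upd z.1 z.2, coord z.1).
have hK : involutive h by case=> w t; rewrite /h /= coord_upd upd_upd upd_coord.
rewrite (reindex_inj (inv_inj hK)) /=.
under eq_bigl do rewrite Pupd.
rewrite (eq_bigr (fun z => G z.1)); last first.
  by case=> w t _ /=; rewrite upd_upd upd_coord.
rewrite -(pair_big_dep P (fun _ => xpredT) (fun w (t : F) => G w)) /=.
under eq_bigr do rewrite sumr_const -[G _ *+ _]mulr_natr.
by rewrite -mulr_suml mulfK// pnatr_eq0 -lt0n.
Qed.

Lemma Expect_resample (G : Omega -> R) : (0 < #|F|)%N ->
  Expect G = Expect (fun w => Expect (fun t => G (upd w t))).
Proof. by move=> F0; rewrite {1}/Expect (@sum_resample predT G (fun _ _ => erefl) F0). Qed.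

(** The fibre of [W] is closed under resampling, and the resampled average is constant on it. *)
Lemma cond_Expect_resample (V : eqType) (W : Omega -> V) (G : Omega -> R) w :
  (0 < #|F|)%N -> (forall w t, W (upd w t) = W w) ->
  (forall w' t, W w' = W w -> G (upd w' t) = G (upd w t)) ->
  cond_Expect G W w = Expect (fun t => G (upd w t)).
Proof.
move=> F0 Wupd Gdep; rewrite /cond_Expect sum_resample//; last first.
  by move=> w' t; rewrite Wupd.
rewrite (eq_bigr (fun=> Expect (fun t => G (upd w t)))); last first.
  by move=> w' /eqP e; apply: eq_Expect => t; exact: Gdep.
rewrite sumr_const -[_ *+ _]mulr_natr mulfK// pnatr_eq0 -lt0n.
by apply/card_gt0P; exists w; rewrite unfold_in; exact: eqxx.
Qed.

End Resampling.

(* Fourier inversion on a cube: every nontrivial character sums to 0 over [A],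
   being negated by an involution of [A]. *)
Lemma uniform_bits (R : realType) (Omega I : finType) (A : pred Omega)
    (Phi : Omega -> I -> bool) (K : {set I}) (h : I -> bool) :
  (forall s : {set I}, s \subset K -> s != finset.set0 ->
     exists2 f : Omega -> Omega, involutive f &
       forall w, A (f w) = A w /\ (A w ->
         \prod_(i in s) (-1) ^+ Phi (f w) i =
         - \prod_(i in s) (-1) ^+ Phi w i :> R)) ->
  \sum_(w | A w) \prod_(i in K) (Phi w i == h i)%:R =
  #|A|%:R / 2 ^+ #|K| :> R.
Proof.
move=> flip.
have fourier w : \prod_(i in K) (Phi w i == h i)%:R =
    2^-1 ^+ #|K| * \sum_(s : {set I} | s \subset K)
      (\prod_(i in s) (-1) ^+ h i * \prod_(i in s) (-1) ^+ Phi w i) :> R.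
  rewrite (eq_bigr (fun i => 2^-1 * (1 + (-1) ^+ h i * (-1) ^+ Phi w i))); last first.
    by move=> i _; case: (Phi w i); case: (h i); rewrite /= ?expr0 ?expr1; lra.
  rewrite big_split prodr_const /=; congr (_ * _).
  (* Outside [K] the factor is 0 + 1, so only subsets of [K] survive when the product is
     expanded. *)
  rewrite big_mkcond (eq_bigr (fun i => (if i \in K then (-1) ^+ h i * (-1) ^+ Phi w i
    else 0) + 1)); last by move=> i _; case: ifP; rewrite ?add0r// addrC.
  rewrite bigA_distr [RHS]big_mkcond; apply: eq_bigr => s _.
  case: ifPn => [/fintype.subsetP sK|/subsetPn[i si iK]].
    rewrite -big_split [RHS]big_mkcond; apply: eq_bigr => i _.
    by case: ifP => // /sK ->.
  by rewrite (bigD1 i)//= si (negbTE iK) mul0r.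
rewrite (eq_bigr _ (fun w _ => fourier w)) -mulr_sumr exchange_big /=.
rewrite (bigD1 finset.set0) ?finset.sub0set//= [X in _ + X]big1 ?addr0; last first.
  move=> s /andP[sK s0]; have [f fK fP] := flip s sK s0.
  rewrite -mulr_sumr; set S := \sum_(w | A w) _.
  suff e : S = - S.
    have e0 : S = 0 by lra.
    by rewrite e0 mulr0.
  rewrite {1}/S (reindex_inj (inv_inj fK)) /= -sumrN; apply: eq_big => w.
    by case: (fP w).
  by move=> Aw; case: (fP w) => e; apply; rewrite -e.
rewrite (eq_bigr (fun=> 1)); last by move=> w _; rewrite !big_set0 mulr1.
by rewrite sumr_const exprVn mulrC.
Qed.

(** Adding it flips one bit of one table entry. The position [i] is a plain number, so that families
    of all lengths can share it. *)
Definition unit_table (k m n : nat) (i : nat) (a : bits k) (b : 'I_n) : tables k m n :=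
  [ffun j : 'I_m => [ffun a' => [ffun b' => [&& j == i :> nat, a' == a & b' == b]]]].

Lemma simple_tab_shift (k m n i : nat) (a : bits k) (b b' : 'I_n)
    (T : tables k m n) (y : seq (bits k)) : (i < m)%N ->
  simple_tab (T + unit_table m i a b) y b' =
  simple_tab T y b' (+) ((b' == b) && (y`_i == a)).
Proof.
move=> im; rewrite /simple_tab.
rewrite (eq_bigr (fun j => T j y`_j + unit_table m i a b j y`_j)); last first.
  by move=> j _; rewrite !ffunE.
rewrite big_split /= ffunE; congr (_ (+) _); rewrite sum_ffunE.
rewrite (bigD1 (Ordinal im))//= !ffunE eqxx /= big1 ?addr0 ?[_ && (b' == b)]andbC//.
by move=> j ji; rewrite !ffunE; rewrite -val_eqE /= in ji; rewrite (negbTE ji).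
Qed.

Lemma unit_tableK (k m n i : nat) (a : bits k) (b : 'I_n) (T : tables k m n) :
  T + unit_table m i a b + unit_table m i a b = T.
Proof.
by apply/ffunP => j; apply/ffunP => a'; apply/ffunP => b'; rewrite !ffunE; exact: addbK.
Qed.

(** * Effect of single bit flips in the tables on derived keys *)

Section DerivedKeys.
Variables (k r c d : nat).
Hypothesis c_gt0 : (0 < c)%N.
Local Notation Omega := (tornado_tables k r c d).
Implicit Types (w : Omega) (x : key k c).

(** The characters on which [event_J] tests linear independence. *)
Definition prefix w x := take (c + d).-1 (derived_key w x).

(* Adds [unit_table] to the family that produces the last derived character,
   which is h_0 when d = 0. *)
Definition shift_last (i : nat) (a : bits k) (b : 'I_k) w : Omega :=
  ((w.1.1 + (if d == 0%N then unit_table c.-1 i a b else 0),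
    [ffun j : 'I_d => w.1.2 j + (if j.+1 == d then unit_table (c + j) i a b else 0)]),
   w.2).

Definition shift_hash (i : nat) (a : bits k) (b : 'I_r) w : Omega :=
  (w.1, w.2 + unit_table (c + d) i a b).

Lemma shift_hashK i a b : involutive (shift_hash i a b).
Proof. by case=> w1 w2; rewrite /shift_hash /= unit_tableK. Qed.

Lemma shift_lastK i a b : involutive (shift_last i a b).
Proof.
case=> [[h0 ht] hh]; rewrite /shift_last /=; congr (_, _, _).
  by case: eqP => _; rewrite ?unit_tableK ?addr0.
by apply/ffunP => j; rewrite !ffunE; case: eqP => _; rewrite ?unit_tableK ?addr0.
Qed.

End DerivedKeys.

Lemma size_foldl_rcons (T I : Type) (g : I -> seq T -> T) (y : seq T) (s : seq I) :
  size (foldl (fun y i => rcons y (g i y)) y s) = (size y + size s)%N.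
Proof. by elim: s y => [|i s IH] y /=; rewrite ?addn0// IH size_rcons addSnnS. Qed.

Lemma derived_key0 (k r c : nat) (w : tornado_tables k r c 0) (x : key k c) :
  derived_key w x = rcons (take c.-1 x) (x`_c.-1 + simple_tab w.1.1 (take c.-1 x)).
Proof. by rewrite /derived_key; case: (enum 'I_0) => [//|[]]. Qed.

Lemma derived_keyS (k r c d : nat) (w : tornado_tables k r c d.+1) (x : key k c) :
  derived_key w x =
  let y := foldl (fun y i =>
      rcons y (simple_tab (w.1.2 (widen_ord (leqnSn d) i)) y))
    (rcons (take c.-1 x) (x`_c.-1 + simple_tab w.1.1 (take c.-1 x)))
    (enum 'I_d) in
  rcons y (simple_tab (w.1.2 ord_max) y).
Proof.
rewrite /derived_key enum_ordSr foldl_rcons /=.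
suff -> : forall (s : seq 'I_d) z,
    foldl (fun y (i : 'I_d.+1) => rcons y (simple_tab (w.1.2 i) y)) z
      [seq widen_ord (leqnSn d) i | i <- s] =
    foldl (fun y i => rcons y (simple_tab (w.1.2 (widen_ord (leqnSn d) i)) y)) z s.
  by [].
by elim=> //= i s IH z; rewrite IH.
Qed.

Lemma size_take_key (k c : nat) (x : key k c) : size (take c.-1 x) = c.-1.
Proof. by rewrite size_take size_tuple; case: ltnP; lia. Qed.

Lemma take_rcons_size (T : Type) (y : seq T) v n : size y = n -> take n (rcons y v) = y.
Proof. by move=> <-; rewrite -cats1 take_size_cat. Qed.

Lemma nth_rcons_size (T : Type) (x0 : T) (y : seq T) v n :
  size y = n -> nth x0 (rcons y v) n = v.
Proof. by move=> <-; rewrite nth_rcons ltnn eqxx. Qed.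

(** Only the family writing the last character changes, which is h_0 when [d = 0] and the last h~
    otherwise; all earlier characters come from unchanged tables. *)
Lemma prefix_shift_last (k r c d : nat) (c_gt0 : (0 < c)%N) i a b
    (w : tornado_tables k r c d) (x : key k c) :
  prefix (shift_last i a b w) x = prefix w x /\
  ((i < (c + d).-1)%N -> forall b', last_char (shift_last i a b w) x b' =
     last_char w x b' (+) ((b' == b) && ((prefix w x)`_i == a))).
Proof.
case: d w => [|d] w.
  have sz : size (take c.-1 x) = (c + 0).-1 by rewrite size_take_key addn0.
  rewrite /prefix /last_char !derived_key0 /=.
  rewrite !(take_rcons_size _ sz) !(nth_rcons_size _ _ sz).
  split=> // ic b'; have ic' : (i < c.-1)%N by lia.
  by rewrite !ffunE simple_tab_shift//; exact: addbA.
rewrite /prefix /last_char !derived_keyS /=.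
set y := foldl _ _ _; set y' := foldl _ _ _.
have -> : y = y'.
  rewrite /y /y' !addr0; move: (rcons _ _) => z; elim: (enum 'I_d) z => //= j s IH z.
  by rewrite IH ffunE /= eqSS ltn_eqF ?addr0.
have sz : size y' = (c + d.+1).-1.
  by rewrite size_foldl_rcons size_rcons size_take_key size_enum_ord; lia.
rewrite !(take_rcons_size _ sz) !(nth_rcons_size _ _ sz).
split=> // ic b'; rewrite ffunE /= eqxx simple_tab_shift//.
by move: ic; rewrite addnS.
Qed.

Lemma nth_prefix (k r c d : nat) (w : tornado_tables k r c d) (x : key k c) i :
  (i < (c + d).-1)%N -> (prefix w x)`_i = (derived_key w x)`_i.
Proof. by move=> ic; rewrite nth_take. Qed.

Lemma prod_bool (R : realType) (I : finType) (P : pred I) :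
  \prod_i (P i)%:R = [forall i, P i]%:R :> R.
Proof.
case: (boolP [forall i, P i]) => [/forallP allP|/forallPn[i iP]].
  by rewrite big1// => i _; rewrite allP.
by rewrite (bigD1 i)//= (negbTE iP) mul0r.
Qed.

(** * Joint uniformity of last characters and hash values *)

Section Independence.
Variables (R : realType) (k r c d : nat).
Hypothesis c_gt0 : (0 < c)%N.
Local Notation Omega := (tornado_tables k r c d).
Local Notation bit := ('I_k + 'I_r)%type.
Implicit Types (w : Omega) (x : key k c) (K : {set key k c}).

Definition output_bit w (z : key k c * bit) : bool :=
  match z.2 with inl b => last_char w z.1 b | inr b => tornado w z.1 b end.

Definition independent K w := lin_indep (c + d).-1 K (derived_key w).

Lemma mem_position_chars (m : nat) (u : 'I_m * bits k) (y : seq (bits k)) :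
  (u \in position_chars m y) = (y`_u.1 == u.2).
Proof.
apply/imsetP/eqP => [[i _ ->]//|e]; exists u.1 => //.
by rewrite e; case: u {e}.
Qed.

(** This form shows invariance under maps that preserve prefixes, and the odd character it supplies
    is where a flip is aimed. *)
Lemma independentE K w : independent K w =
  [forall Y : {set key k c}, (Y \subset K) && (Y != finset.set0) ==>
    [exists u : 'I_(c + d).-1 * bits k, odd #|[set x in Y | (prefix w x)`_u.1 == u.2]|]].
Proof.
rewrite /independent /lin_indep negb_exists; apply: eq_forallb => Y.
rewrite andbA negb_and implybE negb_forall; congr (_ || _).
apply: eq_existsb => u; rewrite negbK; congr (odd _); apply: eq_card => x.
by rewrite !inE mem_position_chars nth_prefix.
Qed.

Lemma tornado_shift_hash i a b w x b' : (i < c + d)%N ->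
  tornado (shift_hash i a b w) x b' =
  tornado w x b' (+) ((b' == b) && ((derived_key w x)`_i == a)).
Proof. exact: simple_tab_shift. Qed.

Definition shift_bit (e : bit) (i : nat) (a : bits k) : Omega -> Omega :=
  match e with inl b => shift_last i a b | inr b => shift_hash i a b end.

Lemma prefix_shift_bit e i a w x : prefix (shift_bit e i a w) x = prefix w x.
Proof.
by case: e => b //=; case: (prefix_shift_last c_gt0 i a b w x).
Qed.

(** The side condition excludes hash bits when the last character is shifted, since that character
    also enters the hash through its table in h^. *)
Lemma output_bit_shift e i a w x e' : (i < (c + d).-1)%N ->
  (if e is inl _ then if e' is inl _ then true else false else true) ->
  output_bit (shift_bit e i a w) (x, e') =
  output_bit w (x, e') (+) ((e' == e) && ((prefix w x)`_i == a)).
Proof.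
move=> ic; case: e e' => b [] b' //= _; rewrite /output_bit /=.
- by case: (prefix_shift_last c_gt0 i a b w x) => _ ->.
- by rewrite addbF; congr (_ _); rewrite /last_char.
by rewrite tornado_shift_hash ?nth_prefix//; lia.
Qed.

(* A nontrivial character of the output bits is flipped by changing h^ if it
   reads some hash bit, and by changing the last h~ otherwise. *)
Lemma output_bit_flip (s : {set key k c * bit}) K :
  s \subset finset.setX K [set: bit] -> s != finset.set0 ->
  exists2 f : Omega -> Omega, involutive f &
    forall w, independent K (f w) = independent K w /\
      (independent K w -> \prod_(z in s) (-1) ^+ output_bit (f w) z =
        - \prod_(z in s) (-1) ^+ output_bit w z :> R).
Proof.
move=> sK s0.
have [e [Y0 se]] : exists e : bit, [set x | (x, e) \in s] != finset.set0 /\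
    forall x e', (x, e') \in s ->
      if e is inl _ then if e' is inl _ then true else false else true.
  case: (pickP [pred z : key k c * bit |
      (z \in s) && (if z.2 is inr _ then true else false)]).
    move=> [x [b|b]] /= /andP[xs // _]; exists (inr b); split=> //.
    by apply/set0Pn; exists x; rewrite inE.
  move=> noh; have /set0Pn[[x [b|b]] xs] := s0; last by have := noh (x, inr b); rewrite /= xs.
  exists (inl b); split; first by apply/set0Pn; exists x; rewrite inE.
  by move=> x' [b'|b'] xs' //; have := noh (x', inr b'); rewrite /= xs'.
set Y := [set x | (x, e) \in s] in Y0.
have YK : Y \subset K.
  apply/fintype.subsetP => x; rewrite inE => /(fintype.subsetP sK).
  by rewrite !inE andbT.
pose odd_char w (u : 'I_(c + d).-1 * bits k) :=
  odd #|[set x in Y | (prefix w x)`_u.1 == u.2]|.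
pose f w := if [pick u | odd_char w u] is Some u then shift_bit e u.1 u.2 w else w.
have prefix_f w x : prefix (f w) x = prefix w x.
  by rewrite /f; case: pickP => // u _; rewrite prefix_shift_bit.
exists f => [w|w].
  (* The choice of [u] depends on prefixes alone, which [f] preserves; so a second application
     repeats the same shift and undoes it. *)
  have pick_f : [pick u | odd_char (f w) u] = [pick u | odd_char w u].
    apply: eq_pick => u; rewrite /odd_char; congr odd; apply: eq_card => x.
    by rewrite !inE prefix_f.
  rewrite {1}/f pick_f /f; case: pickP => // u _.
  by case: (e) => b /=; [exact: shift_lastK|exact: shift_hashK].
split.
  rewrite !independentE; apply: eq_forallb => Z; congr (_ ==> _).
  apply: eq_existsb => u; congr odd; apply: eq_card => x.
  by rewrite !inE prefix_f.
rewrite independentE => /forallP/(_ Y); rewrite YK Y0 /= => /existsP[u0 odd0].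
rewrite /f; case: pickP => [u oddu|/(_ u0)]; last by rewrite /odd_char odd0.
rewrite (eq_bigr (fun z => (-1) ^+ output_bit w z *
  (-1) ^+ ((z.2 == e) && ((prefix w z.1)`_u.1 == u.2)))); last first.
  move=> [x e'] xs; rewrite output_bit_shift//; last exact: se xs.
  by rewrite signr_addb.
rewrite big_split /= mulrC -[RHS]mulN1r; congr (_ * _).
rewrite prodrXr -signr_odd.
(* The number of flipped factors is the odd count that led to the choice of [u]. *)
suff -> : (\sum_(z in s) ((z.2 == e) && ((prefix w z.1)`_u.1 == u.2)%R))%N =
    #|[set x in Y | (prefix w x)`_u.1 == u.2]|.
  by move: oddu; rewrite /odd_char => ->; rewrite expr1.
rewrite -(card_imset _ (f := fun x => (x, e))); last by move=> x y [].
rewrite -sum1_card big_mkcond [RHS]big_mkcond; apply: eq_bigr => -[x e'] _.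
rewrite [in RHS](_ : ((x, e') \in _) =
    [&& (x, e') \in s, e' == e & (prefix w x)`_u.1 == u.2]).
  by case: (_ \in s) => /=; [case: (_ && _)|].
apply/imsetP/idP => [[y yY [-> ->]]|/and3P[xs /eqP e'e px]].
  by move: yY; rewrite !inE => /andP[-> ->]; rewrite eqxx.
by exists x; rewrite -?e'e// !inE px -e'e xs.
Qed.

(** [uniform_bits] gives every pattern of values on [K] the same probability jointly with
    independence; a general [g] follows by summing over patterns. *)
Lemma Expect_independent K (g : key k c -> bits k * bits r -> R) :
  Expect (fun w => (independent K w)%:R *
    \prod_(x in K) g x (last_char w x, tornado w x)) =
  Expect (fun w => (independent K w)%:R) * \prod_(x in K) Expect (g x).
Proof.
pose V : finType := (bits k * bits r)%type.
have V0 : #|V|%:R != 0 :> R.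
  by rewrite pnatr_eq0 -lt0n; apply/card_gt0P; exists (0, 0).
have cardV : #|V|%:R = 2 ^+ #|{: bit}| :> R.
  by rewrite card_prod !card_ffun card_sum !card_ord card_bool -expnD natrX.
pose out w x : V := (last_char w x, tornado w x).
have exact (h : {ffun key k c -> V}) :
    \sum_(w | independent K w) \prod_(x in K) (out w x == h x)%:R =
    #|independent K|%:R * \prod_(x in K) #|V|%:R^-1 :> R.
  pose hb (z : key k c * bit) :=
    match z.2 with inl b => (h z.1).1 b | inr b => (h z.1).2 b end.
  have := uniform_bits hb (@output_bit_flip ^~ K).
  rewrite cardsX cardsT mulnC exprM -cardV prodr_const exprVn => <-.
  apply: eq_bigr => w _; apply/esym.
  rewrite (eq_bigl (fun z => (z.1 \in K) && predT z.2)); last first.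
    by case=> x e; rewrite !inE.
  rewrite -(pair_big (mem K) predT
    (fun x e => (output_bit w (x, e) == hb (x, e))%:R)) /=.
  apply: eq_bigr => x _; rewrite prod_bool; congr (_%:R : R); congr nat_of_bool.
  apply/forallP/eqP => [e|e [b|b]]; last 2 first.
  - by rewrite /hb -e.
  - by rewrite /hb -e.
  rewrite /out [h x]surjective_pairing; congr (_, _); apply/ffunP => b.
    exact/eqP/(e (inl b)).
  exact/eqP/(e (inr b)).
(* Pinning [h] to [v0] outside [K] makes the sum over all [h] count each pattern on [K] once. *)
pose v0 : V := (0, 0).
pose G (x : key k c) (v : V) : R := if x \in K then g x v else (v == v0)%:R.
have GE : \prod_x \sum_v G x v = \prod_(x in K) \sum_v g x v.
  rewrite [RHS]big_mkcond; apply: eq_bigr => x _; rewrite /G; case: ifP => // _.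
  by rewrite (bigD1 v0)//= eqxx big1 ?addr0// => v /negbTE ->.
rewrite {1 2}/Expect mulrAC; congr (_ / _).
transitivity (\sum_(w | independent K w) \prod_(x in K) g x (out w x)).
  rewrite [RHS]big_mkcond; apply: eq_bigr => w _.
  by case: (independent K w); rewrite ?mul1r ?mul0r.
transitivity (\sum_(w | independent K w) \sum_(h : {ffun key k c -> V})
   ((\prod_x G x (h x)) * \prod_(x in K) (out w x == h x)%:R)).
  apply: eq_bigr => w _.
  rewrite (eq_bigr (fun h : {ffun key k c -> V} => \prod_x
    (G x (h x) * (if x \in K then (out w x == h x)%:R else 1)))); last first.
    by move=> h _; rewrite big_split -big_mkcond.
  rewrite -(bigA_distr_bigA (fun x v =>
    G x v * (if x \in K then (out w x == v)%:R else 1))).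
  rewrite big_mkcond; apply: eq_bigr => x _; rewrite /G; case: ifP => _.
    rewrite (bigD1 (out w x))//= eqxx mulr1 big1 ?addr0// => v.
    by rewrite eq_sym => /negbTE ->; rewrite mulr0.
  by rewrite (bigD1 v0)//= eqxx mulr1 big1 ?addr0// => v /negbTE ->; rewrite mul0r.
rewrite exchange_big /=; under eq_bigr do rewrite -mulr_sumr exact.
rewrite -mulr_suml -(bigA_distr_bigA G) GE mulrCA; congr (_ * _).
  by rewrite sum_indicator.
by rewrite -big_split.
Qed.

End Independence.

(** * The upper tail of the second layer *)

Lemma Expect_pair (R : realType) (U V : finType) (f : U -> R) (g : V -> R) :
  Expect (fun z : U * V => f z.1 * g z.2) = Expect f * Expect g.
Proof.
rewrite /Expect card_prod natrM invfM mulrACA; congr (_ * _).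
by rewrite big_distrlr pair_big.
Qed.

Lemma Expect_eq (R : realType) (U : finType) (u : U) :
  Expect (fun v => (v == u)%:R) = #|U|%:R^-1 :> R.
Proof. by rewrite /Expect sum_indicator card1 mul1r. Qed.

Lemma sum_option (R : nmodType) (T : finType) (f : option T -> R) :
  \sum_o f o = f None + \sum_q f (Some q).
Proof.
rewrite (bigD1 None)//=; congr (_ + _).
rewrite (reindex_omap Some id) => [|[q|]//]; apply: eq_bigl => q.
by rewrite eqxx.
Qed.

Lemma lin_indepS (k m : nat) (I : finType) (K A : {set I}) (y : I -> seq (bits k)) :
  K \subset A -> lin_indep m A y -> lin_indep m K y.
Proof.
move=> KA; apply: contraNN => /existsP[Y /and3P[YK Y0 YP]].
by apply/existsP; exists Y; rewrite (fintype.subset_trans YK KA) Y0.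
Qed.

Section MomentBound.
Variables (R : realType) (k r c d : nat).
Hypothesis c_gt0 : (0 < c)%N.
Variable phi : key k c -> bits r -> bool.
Local Notation Omega := (tornado_tables k r c d).
Local Notation key := (key k c).
Implicit Types (w : Omega) (x : key).

Definition select_prob x : R := Expect (fun v : bits r => (phi x v)%:R).

Lemma select_prob_ge0 x : 0 <= select_prob x.
Proof. exact: Expect_ge0. Qed.

Local Notation sigma := (#|{: bits k}|%:R : R).
Local Notation pairing := {ffun bits k -> option (key * key)}.

Definition pair_keys (o : option (key * key)) : {set key} :=
  if o is Some q then [set q.1; q.2] else finset.set0.

(** A factor in the expansion of the product over [alpha]. Pairs are ordered, so each unordered pair
    occurs twice, whence [y / 2]. *)
Definition pairing_term (y : R) (tau : pairing) w (alpha : bits k) : R :=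
  if tau alpha is Some q then
    y / 2 * ([&& q.1 != q.2, q.1 \in selected_at phi w alpha
               & q.2 \in selected_at phi w alpha])%:R
  else 1.

Lemma pairing_term0 y (tau : pairing) w alpha x : x \in pair_keys (tau alpha) ->
  x \notin selected_at phi w alpha -> pairing_term y tau w alpha = 0.
Proof.
rewrite /pairing_term; case: (tau alpha) => [[a b]|]; last by rewrite inE.
by rewrite !inE => /orP[]/eqP <- /negbTE ->; rewrite ?andbF mulr0.
Qed.

(** A pair of equal keys, or a key chosen for two values of [alpha], makes the product vanish.
    Otherwise the chosen keys are distinct, and each contributes [select_prob x / sigma] by full
    randomness. *)
Lemma Expect_pairing (y : R) (tau : pairing) : 0 <= y ->
  Expect (fun w => (event_J phi w)%:R * \prod_alpha pairing_term y tau w alpha) <=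
  \prod_alpha (if tau alpha is Some q then
    y / 2 * (select_prob q.1 * select_prob q.2 / sigma ^+ 2) else 1).
Proof.
move=> y0.
have rhs0 : 0 <= \prod_alpha (if tau alpha is Some q then
    y / 2 * (select_prob q.1 * select_prob q.2 / sigma ^+ 2) else 1).
  apply: prodr_ge0 => alpha _; case: (tau alpha) => // q.
  apply: mulr_ge0; first exact: divr_ge0.
  by apply: divr_ge0; rewrite ?exprn_ge0// mulr_ge0 ?select_prob_ge0.
have null : (forall w, \prod_alpha pairing_term y tau w alpha = 0) ->
    Expect (fun w => (event_J phi w)%:R * \prod_alpha pairing_term y tau w alpha) <=
    \prod_alpha (if tau alpha is Some q then
      y / 2 * (select_prob q.1 * select_prob q.2 / sigma ^+ 2) else 1).
  move=> z; apply: le_trans rhs0; rewrite /Expect big1 ?mul0r// => w _.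
  by rewrite z mulr0.
have [distinct|] := boolP [forall alpha, if tau alpha is Some q then q.1 != q.2 else true];
  last first.
  case/forallPn => alpha; case E: (tau alpha) => [q|//]; rewrite negbK => qq.
  by apply: null => w; rewrite (bigD1 alpha)//= /pairing_term E qq mulr0 mul0r.
have [disj|] := boolP [forall alpha, forall beta, (alpha != beta) ==>
    [disjoint pair_keys (tau alpha) & pair_keys (tau beta)]]; last first.
  case/forallPn => alpha /forallPn[beta]; rewrite negb_imply.
  case/andP => neq /pred0Pn[x /andP[/= xa xb]]; apply: null => w.
  have [xw|xw] := boolP (x \in selected_at phi w alpha); last first.
    by rewrite (bigD1 alpha)//= (pairing_term0 _ xa xw) mul0r.
  rewrite (bigD1 beta)//= (pairing_term0 _ xb) ?mul0r//.
  by move: xw; rewrite !inE => /andP[_ /eqP ->]; rewrite negb_and neq orbT.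
pose K := \bigcup_alpha pair_keys (tau alpha).
(* The default 0 is reached only outside [K]. *)
pose target x : bits k := odflt 0 [pick alpha | x \in pair_keys (tau alpha)].
have disjP alpha beta : alpha != beta ->
    [disjoint pair_keys (tau alpha) & pair_keys (tau beta)].
  by move/forallP: disj => /(_ alpha)/forallP/(_ beta)/implyP.
have targetP alpha x : x \in pair_keys (tau alpha) -> target x = alpha.
  move=> xa; rewrite /target; case: pickP => [beta xb|/(_ alpha)]; last by rewrite xa.
  apply/eqP/negPn/negP => /disjP/pred0P/(_ x).
  by rewrite /= xa xb.
pose g x (v : bits k * bits r) : R := (v.1 == target x)%:R * (phi x v.2)%:R.
pose wt : R := \prod_alpha (if tau alpha is Some q then y / 2 else 1).
have splitK (F : key -> R) : \prod_(x in K) F x =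
    \prod_alpha \prod_(x in pair_keys (tau alpha)) F x.
  exact: partition_disjoint_bigcup.
have prod_pair (F : key -> R) alpha : \prod_(x in pair_keys (tau alpha)) F x =
    if tau alpha is Some q then F q.1 * F q.2 else 1.
  move/forallP: distinct => /(_ alpha); rewrite /pair_keys.
  case: (tau alpha) => [[a b] /= ab|_]; last by rewrite big_set0.
  by rewrite big_setU1 ?big_set1// inE.
have termE w : \prod_alpha pairing_term y tau w alpha =
    wt * \prod_(x in K) g x (last_char w x, tornado w x).
  rewrite splitK -big_split; apply: eq_bigr => alpha _ /=.
  rewrite prod_pair /pairing_term.
  move/forallP: distinct => /(_ alpha).
  have := targetP alpha; case: (tau alpha) => [[a b] /= tE ->|_ _]; last by rewrite mulr1.
  rewrite /g /= !tE ?inE ?eqxx ?orbT//= -!natrM !mulnb; congr (_ * _%:R).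
  by rewrite ![phi _ _ && _]andbC.
apply: (@le_trans _ _ (wt * Expect (fun w => (independent K w)%:R *
    \prod_(x in K) g x (last_char w x, tornado w x)))).
  rewrite -ExpectZ; apply: le_Expect => w; rewrite termE mulrCA.
  have wt0 : 0 <= wt.
    by apply: prodr_ge0 => alpha _; case: (tau alpha) => // q; rewrite divr_ge0.
  have g0 x v : 0 <= g x v by rewrite mulr_ge0.
  apply: ler_wpM2l => //.
  (* If some key of [K] is not selected, both sides vanish; otherwise [event_J] passes to the
     subfamily [K]. *)
  have [KX|/subsetPn[x xK xX]] := boolP (K \subset selected phi w); last first.
    by rewrite (bigD1 x)//= {1 3}/g /=; move: xX; rewrite inE => /negbTE ->; rewrite !(mulr0, mul0r).
  apply: ler_wpM2r; first by apply: prodr_ge0.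
  rewrite ler_nat; case J: (event_J phi w) => //.
  by rewrite lt0b; exact: lin_indepS KX J.
rewrite Expect_independent//.
have gE x : Expect (g x) = select_prob x / sigma.
  transitivity (Expect (fun l => (l == target x)%:R) *
      Expect (fun v => (phi x v)%:R) : R); first exact: Expect_pair.
  by rewrite Expect_eq mulrC.
rewrite (eq_bigr _ (fun x _ => gE x)) splitK.
apply: (@le_trans _ _ (wt * \prod_alpha \prod_(x in pair_keys (tau alpha)) (select_prob x / sigma))).
  apply: ler_wpM2l.
    by apply: prodr_ge0 => alpha _; case: (tau alpha) => // q; rewrite divr_ge0.
  apply: ler_piMl; last by rewrite -PrE Pr_le1.
  by apply: prodr_ge0 => alpha _; apply: prodr_ge0 => x _; rewrite divr_ge0 ?select_prob_ge0.
rewrite -big_split le_eqVlt; apply/orP; left; apply/eqP; apply: eq_bigr => alpha _ /=.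
rewrite prod_pair; case: (tau alpha) => [q|]; last by rewrite mulr1.
by congr (_ * _); rewrite mulrACA -invfM -expr2.
Qed.

Local Notation mu := (\sum_x select_prob x).

(** An [alpha] with two selected keys a, b receives y/2 from (a, b) and y/2 from (b, a), so its
    factor is at least 1 + y. After taking expectations, the sum over pairings factors over [alpha]
    again. *)
Lemma layer2_moment (y : R) : 0 <= y ->
  Expect (fun w => (event_J phi w)%:R * (1 + y) ^+ layer phi 2 w) <=
  (1 + y / 2 * (mu / sigma) ^+ 2) ^+ #|{: bits k}|.
Proof.
move=> y0; have y2 : 0 <= y / 2 by exact: divr_ge0.
pose tm w alpha (o : option (key * key)) : R :=
  if o is Some q then y / 2 * ([&& q.1 != q.2, q.1 \in selected_at phi w alpha
    & q.2 \in selected_at phi w alpha])%:R else 1.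
have pointwise w : (1 + y) ^+ layer phi 2 w <=
    \sum_(tau : pairing) \prod_alpha pairing_term y tau w alpha.
  rewrite -(bigA_distr_bigA (tm w)) /layer -prodr_const big_mkcond.
  apply: ler_prod => alpha _; rewrite sum_option /= inE.
  have tm0 q : 0 <= tm w alpha (Some q) by rewrite mulr_ge0.
  have [/card_gt1P[a [b [aX bX ab]]]|_] := ltnP; last first.
    by rewrite ler01 lerDl; apply: sumr_ge0 => q _; exact: tm0.
  rewrite addr_ge0//= lerD2l (bigD1 (a, b))//= (bigD1 (b, a)) /=; last first.
    by rewrite xpair_eqE negb_and eq_sym ab.
  rewrite aX bX ab eq_sym ab /= mulr1 addrA -splitr lerDl.
  by apply: sumr_ge0 => q _; exact: tm0.
apply: (@le_trans _ _ (Expect (fun w => \sum_(tau : pairing)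
    (event_J phi w)%:R * \prod_alpha pairing_term y tau w alpha))).
  by apply: le_Expect => w; rewrite -mulr_sumr ler_wpM2l.
rewrite Expect_sum.
apply: le_trans; first by apply: ler_sum => tau _; exact: Expect_pairing.
rewrite -(bigA_distr_bigA (fun (_ : bits k) (o : option (key * key)) =>
  if o is Some q then
    y / 2 * (select_prob q.1 * select_prob q.2 / sigma ^+ 2) else 1)) prodr_const.
have muE : \sum_(q : key * key) select_prob q.1 * select_prob q.2 = mu ^+ 2.
  by rewrite expr2 big_distrlr pair_big.
by rewrite sum_option -mulr_sumr -mulr_suml muE exprMn exprVn.
Qed.

Lemma layer2_mgf (y : R) : 0 <= y ->
  Expect (fun w => (event_J phi w)%:R * (1 + y) ^+ layer phi 2 w) <=
  expR (y * (mu ^+ 2 / (2 * sigma))).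
Proof.
move=> y0; apply: le_trans (layer2_moment y0) _.
have s0 : sigma != 0 by rewrite pnatr_eq0 -lt0n; apply/card_gt0P; exists 0.
have -> : y * (mu ^+ 2 / (2 * sigma)) = (y / 2 * (mu / sigma) ^+ 2) * sigma.
  by field.
rewrite expRM_natr lerXn2r ?nnegrE ?expR_ge0 ?expR_ge1Dx//.
by rewrite addr_ge0// mulr_ge0 ?divr_ge0 ?sqr_ge0.
Qed.

End MomentBound.

(** * Conditioning on hbar *)

Section Conditioning.
Variables (R : realType) (k r c d : nat).
Hypothesis c_gt0 : (0 < c)%N.
Variable phi : key k c -> bits r -> bool.
Local Notation Omega := (tornado_tables k r c d).
Local Notation key := (key k c).
Local Notation last_tables := {ffun bits k -> bits r}.
Implicit Types (w : Omega) (x : key) (v : {ffun key -> bits r * bits k}).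
Implicit Types (alpha : bits k) (beta : bits r).
Local Notation sigma := (#|{: bits k}|%:R : R).
Local Notation mu := (\sum_x select_prob R phi x).

Fact last_position_subproof : ((c + d).-1 < c + d)%N.
Proof. by lia. Qed.

Definition last_table w : last_tables := w.2 (Ordinal last_position_subproof).

Definition set_last_table w (T : last_tables) : Omega :=
  (w.1, [ffun j : 'I_(c + d) => if j == (c + d).-1 :> nat then T else w.2 j]).

Lemma set_last_tableK w T : last_table (set_last_table w T) = T.
Proof. by rewrite /last_table ffunE eqxx. Qed.

Lemma set_set_last_table w T T' :
  set_last_table (set_last_table w T) T' = set_last_table w T'.
Proof. by congr (_, _); apply/ffunP => j; rewrite !ffunE; case: eqP. Qed.

Lemma set_last_table_id w : set_last_table w (last_table w) = w.
Proof.
case: w => w1 w2; congr (_, _); apply/ffunP => j; rewrite ffunE.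
by case: eqP => // e; congr (w2 _); apply: val_inj.
Qed.

Lemma hbar_set_last_table w T : hbar (set_last_table w T) = hbar w.
Proof.
apply/ffunP => x; rewrite !ffunE; congr (_, _); apply: eq_bigr => j jc.
by rewrite ffunE ltn_eqF.
Qed.

Lemma tornadoE w x : tornado w x = (hbar w x).1 + last_table w (hbar w x).2.
Proof.
rewrite ffunE /= addrC /tornado /simple_tab.
rewrite (bigD1 (Ordinal last_position_subproof))//=; congr (_ + _).
apply: eq_bigl => j; rewrite -val_eqE /=; have := ltn_ord j; lia.
Qed.

(* The keys in X_alpha when hbar = v and the last table maps alpha to beta. *)
Definition bin v alpha beta : {set key} :=
  [set x | ((v x).2 == alpha) && phi x ((v x).1 + beta)].

Lemma selected_atE w alpha :
  selected_at phi w alpha = bin (hbar w) alpha (last_table w alpha).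
Proof.
apply/setP => x; rewrite !inE tornadoE andbC !ffunE /=.
by case: eqP => // ->.
Qed.

Lemma layerE i w : layer phi i w =
  (\sum_alpha (i <= #|bin (hbar w) alpha (last_table w alpha)|)%N)%N.
Proof.
rewrite /layer -sum1_card big_mkcond; apply: eq_bigr => alpha _.
by rewrite inE selected_atE; case: (_ <= _)%N.
Qed.

(** [N >= 1] + [N >= 2] = min(N, 2). *)
Lemma layer_le2E w : layer_le2 phi w =
  (\sum_alpha minn #|bin (hbar w) alpha (last_table w alpha)| 2)%N.
Proof.
rewrite /layer_le2 !layerE -big_split; apply: eq_bigr => alpha _ /=.
by case: #|_| => [|[|n]] //=.
Qed.

Lemma card_selectedE w : #|selected phi w| =
  (\sum_alpha #|bin (hbar w) alpha (last_table w alpha)|)%N.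
Proof.
rewrite -sum1_card (partition_big (last_char w) predT)//=; apply: eq_bigr => alpha _.
by rewrite -selected_atE -sum1_card; apply: eq_bigl => x; rewrite !inE.
Qed.

Lemma bits_gt0 n : (0 < #|{: bits n}|)%N.
Proof. by apply/card_gt0P; exists 0. Qed.

Lemma last_tables_gt0 : (0 < #|last_tables|)%N.
Proof. exact: card_ffun_gt0 (bits_gt0 r). Qed.

(** Given [v], each key can lie in one bin only, and translation by [(v x).1] keeps [beta] uniform.
    The value is the same for every [v]. *)
Lemma sum_Expect_bin v :
  \sum_alpha Expect (fun beta => #|bin v alpha beta|%:R) = mu.
Proof.
transitivity (\sum_alpha \sum_x Expect (fun beta =>
    ((v x).2 == alpha)%:R * (phi x ((v x).1 + beta))%:R) : R).
  apply: eq_bigr => alpha _; rewrite -Expect_sum; apply: eq_Expect => beta.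
  rewrite -sum1_card natr_sum big_mkcond; apply: eq_bigr => x _.
  by rewrite inE; case: (_ == _); case: (phi _ _); rewrite /= ?mulr1 ?mulr0.
rewrite exchange_big; apply: eq_bigr => x _.
rewrite (bigD1 (v x).2)//= [X in _ + X]big1 ?addr0 => [|alpha]; last first.
  by rewrite eq_sym => /negbTE ->; rewrite ExpectZ mul0r.
rewrite eqxx ExpectZ mul1r /select_prob /Expect; congr (_ / _).
by rewrite [RHS](reindex_inj (addrI (v x).1)).
Qed.

(* E[S_1 + S_2 | hbar = v] and E[S_2 | hbar = v]. *)
Definition cond_mean v : R :=
  \sum_alpha Expect (fun beta => (minn #|bin v alpha beta| 2)%:R).

Definition cond_mean2 v : R :=
  \sum_alpha Expect (fun beta => (2 <= #|bin v alpha beta|)%N%:R).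

Lemma mean_selectedE : mean_selected R d phi = mu.
Proof.
rewrite /mean_selected (Expect_resample set_last_tableK set_set_last_table
  set_last_table_id)//; last exact: last_tables_gt0.
rewrite (@eq_Expect _ _ _ (fun=> mu)); last first.
  move=> w; rewrite -(sum_Expect_bin (hbar w)).
  rewrite (@eq_Expect _ _ _ (fun T : last_tables =>
    \sum_alpha #|bin (hbar w) alpha (T alpha)|%:R)); last first.
    by move=> T; rewrite card_selectedE natr_sum hbar_set_last_table set_last_tableK.
  rewrite Expect_sum; apply: eq_bigr => alpha _.
  exact: (Expect_coord (bits_gt0 r) alpha (fun beta => #|bin (hbar w) alpha beta|%:R)).
rewrite Expect_cst//; apply/card_gt0P.
by exists ((0, [ffun=> 0]), 0).
Qed.

Lemma layer_le2_set_last_table w T : (layer_le2 phi (set_last_table w T))%:R =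
  \sum_alpha (minn #|bin (hbar w) alpha (T alpha)| 2)%:R :> R.
Proof. by rewrite layer_le2E natr_sum hbar_set_last_table set_last_tableK. Qed.

Lemma cond_Expect_layer_le2 w :
  cond_Expect (fun w' => (layer_le2 phi w')%:R) (fun w' => hbar w') w =
  cond_mean (hbar w).
Proof.
rewrite (cond_Expect_resample set_last_tableK set_set_last_table set_last_table_id
  last_tables_gt0 hbar_set_last_table); last first.
  by move=> w' T e; rewrite !layer_le2_set_last_table e.
rewrite (@eq_Expect _ _ _ (fun T : last_tables =>
  \sum_alpha (minn #|bin (hbar w) alpha (T alpha)| 2)%:R)); last first.
  by move=> T; rewrite layer_le2_set_last_table.
rewrite Expect_sum; apply: eq_bigr => alpha _.
exact: (Expect_coord (bits_gt0 r) alpha (fun beta => (minn #|bin (hbar w) alpha beta| 2)%:R)).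
Qed.

(* Y^2 = Y + 2 [N >= 2] for Y = min(N, 2), and by Cauchy-Schwarz the sum of the
   (E Y)^2 is at least (E S)^2 / sigma; finally E S <= mu <= sigma / 2 and
   t - t^2 / sigma increases up to sigma / 2. *)
Lemma cond_variance_le v : mu <= sigma / 2 ->
  \sum_alpha (Expect (fun beta => (minn #|bin v alpha beta| 2)%:R ^+ 2)
    - Expect (fun beta => (minn #|bin v alpha beta| 2)%:R) ^+ 2) <=
  mu + 2 * (cond_mean2 v - mu ^+ 2 / (2 * sigma)).
Proof.
move=> mu_le; have s0 : 0 < sigma by rewrite ltr0n bits_gt0.
set m := fun alpha => Expect (fun beta => (minn #|bin v alpha beta| 2)%:R) : R.
rewrite sumrB.
have -> : \sum_alpha Expect (fun beta => (minn #|bin v alpha beta| 2)%:R ^+ 2) =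
    cond_mean v + 2 * cond_mean2 v :> R.
  rewrite /cond_mean /cond_mean2 mulr_sumr -big_split; apply: eq_bigr => alpha _.
  rewrite /= -ExpectZ -ExpectD; apply: eq_Expect => beta.
  by rewrite -natrX -natrM -natrD; case: #|_| => [|[|n]].
have cs : cond_mean v ^+ 2 / sigma <= \sum_alpha m alpha ^+ 2.
  have : 0 <= \sum_alpha (m alpha - cond_mean v / sigma) ^+ 2.
    by apply: sumr_ge0 => alpha _; exact: sqr_ge0.
  rewrite (eq_bigr (fun alpha => (m alpha ^+ 2 - 2 * (cond_mean v / sigma) * m alpha)
    + (cond_mean v / sigma) ^+ 2)); last by move=> alpha _; ring.
  rewrite big_split sumrB /= -mulr_sumr sumr_const -[(_ ^+ 2) *+ _]mulr_natr.
  have -> : (cond_mean v / sigma) ^+ 2 * sigma = cond_mean v ^+ 2 / sigma.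
    by field; rewrite gt_eqF.
  rewrite -/(cond_mean v) -[2 * _ * _]mulrA [_ / sigma * _]mulrAC -expr2; lra.
have mean0 : 0 <= cond_mean v by apply: sumr_ge0 => alpha _; exact: Expect_ge0.
have mean_mu : cond_mean v <= mu.
  rewrite -(sum_Expect_bin v); apply: ler_sum => alpha _; apply: le_Expect => beta.
  by rewrite ler_nat geq_minl.
have incr : cond_mean v - cond_mean v ^+ 2 / sigma <= mu - mu ^+ 2 / sigma.
  rewrite -(ler_pM2r s0) !mulrBl !divfK ?gt_eqF//; nra.
have -> : mu + 2 * (cond_mean2 v - mu ^+ 2 / (2 * sigma)) =
  mu - mu ^+ 2 / sigma + 2 * cond_mean2 v by field; rewrite gt_eqF.
lra.
Qed.

(** The median bound needs an integer; rounding the conditional mean down loses less than 1, which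
    the [+ 1] absorbs. *)
Lemma cond_layer2_median w (t : R) : t + 1 < cond_mean2 (hbar w) ->
  1 / 2 <= Expect (fun T : last_tables =>
    (t < (layer phi 2 (set_last_table w T))%:R)%R%:R : R).
Proof.
move=> tm; pose Z alpha beta := (2 <= #|bin (hbar w) alpha beta|)%N.
have m0 : 0 <= cond_mean2 (hbar w).
  by apply: sumr_ge0 => alpha _; exact: Expect_ge0.
have /andP[mle mlt] := truncn_itv m0.
set m := Num.truncn _ in mle mlt.
apply: le_trans (poisson_binomial_median (bits_gt0 r) (Z := Z) mle) _.
apply: le_Expect => T; rewrite ler_nat layerE hbar_set_last_table set_last_tableK.
have [mT|_] := leqP m _; last by [].
rewrite (lt_le_trans (y := m%:R)) ?ler_nat//.
by move: mlt; rewrite -natr1; lra.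
Qed.

End Conditioning.

(** * The lower tail *)

Section MainBounds.
Variables (R : realType) (k r c d : nat).
Hypothesis c_gt0 : (0 < c)%N.
Variable phi : key k c -> bits r -> bool.
Local Notation Omega := (tornado_tables k r c d).
Local Notation sigma := (#|{: bits k}|%:R : R).
Local Notation mu := (mean_selected R d phi).
Local Notation mu2 := (mubar R d phi 2).
Local Notation a2 w := (cond_mean2 R phi (hbar w)).

Lemma tornado_tables_gt0 : (0 < #|{: Omega}|)%N.
Proof. by apply/card_gt0P; exists ((0, [ffun=> 0]), 0). Qed.

Lemma mubar2E : mu2 = mu ^+ 2 / (2 * sigma).
Proof.
have s0 : sigma != 0 by rewrite pnatr_eq0 -lt0n bits_gt0.
by rewrite /mubar /frac_selected (_ : 2`! = 2)%N//; field.
Qed.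

(** Markov's inequality for [(1 + delta) ^+ layer phi 2 w], the optimal base for a Poisson variable
    of mean [mu2]. *)
Lemma layer2_chernoff (delta : R) : 0 <= delta -> delta <= Num.sqrt 3 ->
  Expect (fun w : Omega => (event_J phi w)%:R *
    ((1 + delta) * mu2 < (layer phi 2 w)%:R)%R%:R) <=
  expR (- (delta ^+ 2 * mu2 / 3)).
Proof.
move=> d0 d3; have d1 : 0 < 1 + delta by lra.
have l0 : 0 <= ln (1 + delta) by rewrite ln_ge0//; lra.
pose u := (1 + delta) * mu2.
have mu20 : 0 <= mu2.
  by rewrite mubar2E divr_ge0 ?sqr_ge0 ?mulr_ge0.
apply: (@le_trans _ _ (Expect (fun w : Omega => expR (- (u * ln (1 + delta))) *
    ((event_J phi w)%:R * (1 + delta) ^+ layer phi 2 w)))).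
  apply: le_Expect => w; rewrite [leRHS]mulrCA ler_wpM2l//.
  have -> : (1 + delta) ^+ layer phi 2 w = expR ((layer phi 2 w)%:R * ln (1 + delta)).
    by rewrite expRM_natl lnK.
  rewrite -expRD; case: ltP => [lt|_]; last exact: expR_ge0.
  apply: le_trans (expR_ge1Dx _).
  by rewrite lerDl addrC -mulrBl mulr_ge0// subr_ge0 ltW.
rewrite ExpectZ; apply: (@le_trans _ _ (expR (- (u * ln (1 + delta))) * expR (delta * mu2))).
  rewrite ler_wpM2l ?expR_ge0// mubar2E (mean_selectedE R d c_gt0).
  exact: layer2_mgf.
rewrite -expRD ler_expR /u.
have := ler_wpM2r mu20 (ln_ge_rational d0 d3); lra.
Qed.

(** Whenever the conditional mean is this large, resampling the last table pushes S_2 above [t] with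
    probability at least 1/2; hence the factor 2. *)
Lemma cond_mean2_tail (delta : R) : 0 <= delta -> delta <= Num.sqrt 3 ->
  Expect (fun w : Omega => ((1 + delta) * mu2 + 1 < a2 w)%R%:R) <=
  2 * (expR (- (delta ^+ 2 * mu2 / 3))
       + Pr R [pred w : Omega | ~~ event_J phi w]).
Proof.
move=> d0 d3; set t := (1 + delta) * mu2.
apply: (@le_trans _ _ (2 * Expect (fun w : Omega => (t < (layer phi 2 w)%:R)%R%:R))).
  rewrite (Expect_resample (set_last_tableK c_gt0) (@set_set_last_table _ _ _ _)
    (set_last_table_id c_gt0) (fun w => (t < (layer phi 2 w)%:R)%R%:R)); last exact: last_tables_gt0.
  rewrite -ExpectZ; apply: le_Expect => w.
  case: ltP => [/(cond_layer2_median c_gt0)|_] /=; first by lra.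
  by rewrite mulr_ge0 ?Expect_ge0.
rewrite ler_pM2l//; apply: le_trans (lerD (layer2_chernoff d0 d3) (lexx _)).
rewrite PrE -ExpectD; apply: le_Expect => w /=.
by case: (event_J phi w); case: (_ < _); rewrite /= ?mul1r ?mul0r ?addr0 ?add0r.
Qed.

(** Bernstein's inequality in each fibre of [hbar]; where the conditional mean of S_2 exceeds [t],
    the integrand is 0. *)
Lemma layer_le2_lower_tail (V L t : R) : mu <= sigma / 2 -> 0 < L ->
  mu + 2 * (t - mu2) < V ->
  Expect (fun w : Omega => ((layer_le2 phi w)%:R <=
      cond_Expect (fun w' : Omega => (layer_le2 phi w')%:R)
        (fun w' : Omega => hbar w') w
      - Num.sqrt (2 * L * V) - 2 / 3 * L)%R%:R * (a2 w <= t)%R%:R) < expR (- L).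
Proof.
move=> mu_le L0 Vgt.
rewrite (Expect_resample (set_last_tableK c_gt0) (@set_set_last_table _ _ _ _)
  (set_last_table_id c_gt0)); last exact: last_tables_gt0.
rewrite -[ltRHS](@Expect_cst R {: Omega}) ?tornado_tables_gt0//.
apply: lt_Expect => [|w]; first exact: tornado_tables_gt0.
have [at_|lt_a2] := leP (a2 w) t; last first.
  rewrite (@eq_Expect _ _ _ (fun=> 0)) ?Expect_cst ?expR_gt0 ?last_tables_gt0//.
  by move=> T; rewrite hbar_set_last_table [_ <= t]leNgt lt_a2 mulr0.
pose Y (alpha : bits k) (beta : bits r) : R := (minn #|bin phi (hbar w) alpha beta| 2)%:R.
rewrite (@eq_Expect _ _ _ (fun T : {ffun bits k -> bits r} =>
  (\sum_alpha Y alpha (T alpha) <= \sum_alpha Expect (Y alpha)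
   - Num.sqrt (2 * L * V) - 2 / 3 * L)%R%:R)); last first.
  move=> T; rewrite (cond_Expect_layer_le2 R c_gt0) hbar_set_last_table// at_ mulr1.
  by rewrite layer_le2_set_last_table.
apply: bernstein_lower_tail => //; first exact: bits_gt0.
  by move=> alpha beta; rewrite ler0n ler_nat geq_minr.
apply: le_lt_trans Vgt.
have := @cond_variance_le R k r c phi (hbar w).
rewrite -(mean_selectedE R d c_gt0) -mubar2E => /(_ mu_le) vle.
by apply: le_trans vle _; lra.
Qed.

End MainBounds.

Theorem theorem13 (R : realType) (k r c d : nat) (c_gt0 : (0 < c)%N)
    (B : {set 'I_r}) (phi : key k c -> bits r -> bool)
    (phi_sel : is_selector B phi) (s_sec p : R) :
  let mu : R := mean_selected R d phi in
  let sigma : R := #|{: bits k}|%:R in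
  let eps2 : R := Num.sqrt (6 * ln (s_sec / p) / sigma)
                  + (2 / 9 * ln (1 / p) + 2) / mu in
  mu <= sigma / 2 ->
  0 < s_sec -> 0 < p -> p < 1 ->
  ln (s_sec / p) <= mubar R d phi 2 ->
  Pr R [pred w : tornado_tables k r c d |
          (layer_le2 phi w)%:R
          <= cond_Expect (fun w' : tornado_tables k r c d => (layer_le2 phi w')%:R)
               (fun w' : tornado_tables k r c d => hbar w') w
             - Num.sqrt (2 * ln (1 / p) * mu * (1 + eps2))
             - 2 / 3 * ln (1 / p)]
  < (1 + 2 / s_sec) * p + 2 * Pr R [pred w : tornado_tables k r c d | ~~ event_J phi w].
Proof.
move=> mu sigma eps2 mu_le s_gt0 p_gt0 p_lt1 ln_le.
(* If [s_sec <= p], then 2p/s_sec is at least 2 and the bound exceeds 1. Otherwise ln(s_sec/p) is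
   positive. *)
have [sp|ps] := leP s_sec p.
  apply: (le_lt_trans (Pr_le1 _ _)); apply: ltr_wpDr; first by rewrite mulr_ge0 ?Pr_ge0.
  rewrite mulrDl mul1r mulrAC; apply: ltr_wpDl; first exact: ltW.
  by rewrite ltr_pdivlMr//; lra.
pose L := ln (1 / p); pose M := ln (s_sec / p); pose mu2 := mubar R d phi 2.
have L_gt0 : 0 < L by rewrite ln_gt0// ltr_pdivlMr// mul1r.
have M_gt0 : 0 < M by rewrite ln_gt0// ltr_pdivlMr// mul1r.
have mu2_gt0 : 0 < mu2 by exact: lt_le_trans ln_le.
have sigma_gt0 : 0 < sigma by rewrite ltr0n bits_gt0.
have mu2E : mu2 = mu ^+ 2 / (2 * sigma) by exact: mubar2E.
have mu_gt0 : 0 < mu.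
  have : 0 <= mu by apply: Expect_ge0.
  rewrite le_eqVlt => /orP[/eqP mu0|//].
  by move: mu2_gt0; rewrite mu2E -mu0 expr0n mul0r ltxx.
have eL : expR (- L) = p by rewrite /L div1r lnV ?posrE// opprK lnK.
have eM : expR (- M) = p / s_sec.
  by rewrite expRN lnK ?posrE ?divr_gt0// invf_div.
(* Chosen so that the Chernoff exponent delta^2 mu2 / 3 equals [M]; then [M <= mu2] becomes
   [delta <= Num.sqrt 3]. *)
pose delta := Num.sqrt (3 * M / mu2).
have delta_ge0 : 0 <= delta by exact: sqrtr_ge0.
have ratio_ge0 : 0 <= 3 * M / mu2.
  by apply: divr_ge0; [apply: mulr_ge0 => //|]; exact: ltW.
have delta2 : delta ^+ 2 * mu2 = 3 * M.
  by rewrite sqr_sqrtr// divfK// gt_eqF.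
have delta_le : delta <= Num.sqrt 3.
  by rewrite ler_sqrt// ler_pdivrMr// ler_pM2l.
(* Both sides equal 2 sqrt(3 M mu2), because mu2 = mu^2 / (2 sigma). *)
have epsE : 2 * (delta * mu2) = mu * Num.sqrt (6 * M / sigma).
  have q0 : 0 <= 6 * M / sigma.
    by apply: divr_ge0; [apply: mulr_ge0 => //|]; exact: ltW.
  have l0 : 0 <= 2 * (delta * mu2).
    by apply: mulr_ge0 => //; apply: mulr_ge0 => //; exact: ltW.
  have r0 : 0 <= mu * Num.sqrt (6 * M / sigma).
    by apply: mulr_ge0; [exact: ltW|exact: sqrtr_ge0].
  apply/eqP; rewrite -(@eqrXn2 _ 2)//; apply/eqP.
  have -> : (2 * (delta * mu2)) ^+ 2 = 4 * (delta ^+ 2 * mu2) * mu2 by ring.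
  rewrite delta2 exprMn [Num.sqrt _ ^+ 2]sqr_sqrtr// mu2E.
  by field; rewrite gt_eqF.
pose bad (w : tornado_tables k r c d) := (1 + delta) * mu2 + 1 < cond_mean2 R phi (hbar w).
(* The two sides differ by 2/9 ln(1/p), which provides the strict inequality; the 2 in [eps2] is
   twice the rounding loss 1. *)
have V_gt : mu + 2 * (((1 + delta) * mu2 + 1) - mu2) < mu * (1 + eps2).
  have -> : mu * (1 + eps2) =
      mu + mu * Num.sqrt (6 * M / sigma) + (2 / 9 * L + 2).
    by rewrite /eps2 -/M -/L; field; rewrite gt_eqF.
  by rewrite -epsE; lra.
have good := layer_le2_lower_tail c_gt0 mu_le L_gt0 V_gt; rewrite eL in good.
have bound := cond_mean2_tail d c_gt0 phi delta_ge0 delta_le.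
have e3 : delta ^+ 2 * mu2 / 3 = M by rewrite delta2; field.
rewrite -/mu2 e3 eM in bound.
apply: (le_lt_trans (Pr_le_split _ _ bad)).
have -> : (1 + 2 / s_sec) * p = p + 2 * (p / s_sec) by field; rewrite gt_eqF.
rewrite -addrA -mulrDr; apply: ltr_leD bound.
apply: le_lt_trans good.
rewrite le_eqVlt; apply/orP; left; apply/eqP; apply: eq_Expect => w.
by rewrite /bad -leNgt /= [2 * L * (mu * _)]mulrA.
Qed.
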